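(* Let $1<\alpha<2$, $1<\beta<2$, $0<\eta<1$, $0<\xi<1$, $\lambda>0$, $\mu>0$. Let $\psi\in C^2([0,1],\mathbb{R})$ be increasing with $\psi'(t)\neq 0$ for all $t\in[0,1]$, and suppose that $$\Delta_1=\lambda(\psi(\eta)-\psi(0))-(\psi(1)-\psi(0))\neq 0,\qquad \Delta_2=\mu(\psi(\xi)-\psi(0))-(\psi(1)-\psi(0))\neq 0.$$ Let $f,g:[0,1]\times\mathbb{R}^2\to\mathbb{R}$ be continuous, and suppose there exist real constants $k_1,k_2,l_1,l_2\geq 0$ and $k_0>0$, $l_0>0$ such that for all $t\in[0,1]$ and all $x,y\in\mathbb{R}$, $$|f(t,x,y)|\leq k_0+k_1|x|+k_2|y|,\qquad |g(t,x,y)|\leq l_0+l_1|x|+l_2|y|.$$ For $i=1,2$ put $$\Omega_i=\frac{k_i}{\Gamma(\alpha+1)}\left[(\psi(1)-\psi(0))^{\alpha}+\frac{|\lambda|+1}{|\Delta_1|}(\psi(1)-\psi(0))^{\alpha+1}\right]+\frac{l_i}{\Gamma(\beta+1)}\left[(\psi(1)-\psi(0))^{\beta}+\frac{|\mu|+1}{|\Delta_2|}(\psi(1)-\psi(0))^{\beta+1}\right],$$ and let $\Omega^{*}=\max\{\Omega_1,\Omega_2\}$. If $\Omega^{*}<1$, then the coupled system $$\begin{cases}{}^{C}D_{0^{+}}^{\alpha;\psi}x(t)=f(t,x(t),y(t)), & t\in[0,1],\\ {}^{C}D_{0^{+}}^{\beta;\psi}y(t)=g(t,x(t),y(t)), &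 t\in[0,1],\\ x(0)=y(0)=0,\\ x(1)=\lambda x(\eta),\quad y(1)=\mu y(\xi)\end{cases}$$ has at least one solution on $[0,1]$.
   Context: $\Gamma$ is the Euler Gamma function. For $\theta>0$ and an integrable $\sigma:[0,1]\to\mathbb{R}$, the left-sided $\psi$-Riemann-Liouville fractional integral of order $\theta$ is $$I_{0^+}^{\theta;\psi}\sigma(t)=\frac{1}{\Gamma(\theta)}\int_0^t\psi'(s)(\psi(t)-\psi(s))^{\theta-1}\sigma(s)\,ds .$$ For $1<\theta<2$ and $\psi,\sigma\in C^2([0,1],\mathbb{R})$ with $\psi$ increasing and $\psi'(t)\neq0$ on $[0,1]$, the left-sided $\psi$-Riemann-Liouville derivative of order $\theta$ is $$D_{0^+}^{\theta;\psi}\sigma(t)=\left(\frac{1}{\psi'(t)}\frac{d}{dt}\right)^{2}I_{0^+}^{2-\theta;\psi}\sigma(t),$$ and the left-sided $\psi$-Caputo fractional derivative of order $\theta$ is $${}^{C}D_{0^+}^{\theta;\psi}\sigma(t)=D_{0^+}^{\theta;\psi}\left[\sigma(t)-\sum_{k=0}^{1}\frac{\sigma_\psi^{[k]}(0)}{k!}(\psi(t)-\psi(0))^k\right],\qquad \sigma_\psi^{[k]}(t)=\left(\frac{1}{\psi'(t)}\frac{d}{dt}\right)^{k}\sigma(t),$$ which for such $\sigma$ equals $I_{0^+}^{2-\theta;\psi}\sigma_\psi^{[2]}(t)$. Solutions $(x,y)$ of the system are considered as elements of $X\times Y$, where $X=Y=C([0,1],\mathbb{R})$ with the supremum norm and $\|(x,y)\|_{X\times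 Y}=\|x\|_X+\|y\|_Y$. *)

(* Defs.v *)
From HB Require Import structures.
From mathcomp Require Import all_boot all_order all_algebra.
From mathcomp Require Import all_classical all_reals all_analysis.
Set Implicit Arguments.
Unset Strict Implicit.
Unset Printing Implicit Defensive.
Import Order.TTheory GRing.Theory Num.Theory.
Import numFieldNormedType.Exports.
Local Open Scope classical_set_scope.
Local Open Scope ring_scope.

(** A function [0,1] -> R is represented by a function R -> R of which only the
    values on [0,1] matter; no notion below depends on the values elsewhere. *)

Section UnitInterval.
Context {R : realType}.
Implicit Types (h : R -> R) (t : R).

(** Points s tending to t inside [0,1], s != t: the derivative is two-sided in
    ]0,1[ and one-sided at the end points. *)
Definition diffquot01 h t : R -> R := fun s => (h s - h t) / (s - t).

Definition derivable01 h t : Prop :=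
  cvg (diffquot01 h t @ within `[0, 1] t^').

(** Meaningful only under [derivable01 h t] and t in [0,1]. *)
Definition deriv01 h t : R := lim (diffquot01 h t @ within `[0, 1] t^').

Definition C2_01 h : Prop :=
  [/\ {in `[0, 1], forall t, derivable01 h t},
      {in `[0, 1], forall t, derivable01 (deriv01 h) t} &
      {within `[0, 1], continuous (deriv01 (deriv01 h))}].

End UnitInterval.

(** The Euler integral, for z > 0. *)
Definition Gamma {R : realType} (z : R) : R :=
  \int[@lebesgue_measure R]_(t in `]0, +oo[) (t `^ (z - 1) * expR (- t)).

Section PsiFractional.
Context {R : realType}.
Implicit Types (psi sigma : R -> R) (theta t : R).

(** (1 / psi'(t)) d/dt *)
Definition psi_deriv psi sigma : R -> R :=
  fun t => deriv01 sigma t / deriv01 psi t.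

Definition psi_derivn psi (k : nat) sigma : R -> R :=
  iter k (psi_deriv psi) sigma.

(** The singularity of the kernel at s = t (for theta < 1) is a null set, where
    powR takes the value 0. *)
Definition psi_RLint theta psi sigma : R -> R := fun t =>
  (Gamma theta)^-1 *
  \int[@lebesgue_measure R]_(s in `[0, t])
    (deriv01 psi s * (psi t - psi s) `^ (theta - 1) * sigma s).

(** 1 < theta < 2 in all that follows. *)
Definition psi_RLderiv theta psi sigma : R -> R :=
  psi_derivn psi 2 (psi_RLint (2 - theta) psi sigma).

Definition psi_RLderivable theta psi sigma : Prop :=
  {in `[0, 1], forall t,
     derivable01 (psi_RLint (2 - theta) psi sigma) t /\
     derivable01 (psi_deriv psi (psi_RLint (2 - theta) psi sigma)) t}.

Definition psi_taylor_rest psi sigma : R -> R := fun t =>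
  sigma t - \sum_(k < 2) psi_derivn psi k sigma 0 / k`!%:R
                         * (psi t - psi 0) ^+ k.

Definition psi_Caputo theta psi sigma : R -> R :=
  psi_RLderiv theta psi (psi_taylor_rest psi sigma).

(** All the derivatives occurring in [psi_Caputo theta psi sigma] on [0,1]
    exist.  C^2 regularity of sigma is not required: solutions of fractional
    equations (for instance (psi - psi 0)^theta) are usually not C^2 at 0. *)
Definition psi_Caputo_derivable theta psi sigma : Prop :=
  derivable01 sigma 0 /\ psi_RLderivable theta psi (psi_taylor_rest psi sigma).

(** [psi_Caputo theta psi sigma = rhs] on [0,1], the left-hand side being
    defined there. *)
Definition psi_Caputo_eq theta psi sigma (rhs : R -> R) : Prop :=
  psi_Caputo_derivable theta psi sigma /\
  {in `[0, 1], forall t, psi_Caputo theta psi sigma t = rhs t}.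

End PsiFractional.

(** The summand of Omega_i attached to one equation of the system, with c the
    growth constant (k_i or l_i), p the multiplier in the boundary condition and
    d the corresponding Delta. *)
Definition Omega_part {R : realType} (psi : R -> R) (theta c p d : R) : R :=
  c / Gamma (theta + 1) *
  ((psi 1 - psi 0) `^ theta +
   (`|p| + 1) / `|d| * (psi 1 - psi 0) `^ (theta + 1)).

(* Main.v *)
Require Import Defs.
From HB Require Import structures.
From mathcomp Require Import all_boot all_order all_algebra.
From mathcomp Require Import all_classical all_reals all_analysis.
From mathcomp Require Import measurable_realfun ring lra.
Import Order.TTheory GRing.Theory Num.Theory.
Import numFieldNormedType.Exports.
Local Open Scope classical_set_scope.
Local Open Scope ring_scope.

(** Brouwer's theorem in the plane is enough, because a discretization leaves only the two
    slopes at 0 undetermined.  For [n > 0] freeze the (truncated) nonlinearities on the cells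
    of the grid [j / n]: the equations become [X t = c (psi t - psi 0) + sum_j W_j(t) f_j] with
    explicit weights, so the values at the grid points are computed from left to right and
    depend continuously on the slopes [(c, d)].  The boundary conditions then say that [(c, d)]
    is a fixed point of a bounded continuous self-map of the plane.  The increments of the
    weights in [t] are nonnegative (convexity of [r ^ alpha]), which bounds the discrete
    solutions and their moduli of continuity uniformly, so they converge along a free
    ultrafilter.  By the Beta identity the fractional integral of order [2 - alpha] turns
    [W_j] into a second difference of [(psi t - psi s)^2 / 2]; hence in the limit it turns the
    fractional part of [x] into a twofold iterated integral of [f(., x, y)], whose derivatives
    are immediate.  Finally [Omega* < 1] bounds the limit, so that the truncation is void. *)

(** Shooting in the slopes at 0 fails for the system itself: [f] and [g] are only continuous, so an
    initial value problem may have several solutions and possibly no continuous choice among them.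
    The explicit scheme gives back a single-valued continuous map, at the price of a limit. For a
    general continuous right-hand side, the composition rule for fractional integrals asks for an
    exchange of singular integrals. For a step function it is a computation with powers, and both
    sides of that computation survive uniform convergence. An ultrafilter replaces the extraction of
    subsequences: the slopes, the values at all points and any test sequence of points converge
    along one and the same filter. The constants come from solving a boundary condition for the
    slope: [c * Delta1 = z 1 - lambda * z eta] bounds [c] by (|lambda| + 1) / |Delta1| times the
    supremum of |z|, where [z] is the fractional part of [x]. Adding the linear part, at most |c|
    (psi 1 - psi 0), produces the bracket in Omega_i. *)

(** * Sperner's lemma on a grid and Brouwer's theorem in the plane *)

Section GridSearch.
Variables (a b : nat -> nat -> bool) (n : nat).
Hypotheses (a_left : forall j, ~~ a 0%N j) (a_right : forall j, a n j).
Hypotheses (b_bottom : forall i, ~~ b i 0%N) (b_top : forall i, b i n).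

(* Labels 0, 1, 2 are [~~ a], [a && ~~ b], [a && b]; this is the parity of
   an edge joining the labels 0 and 1. *)
Let edge01 i j i' j' : bool :=
  (~~ a i j && (a i' j' && ~~ b i' j')) ||
  (~~ a i' j' && (a i j && ~~ b i j)).

Let vertices01 i j (P : bool -> bool -> bool) : Prop :=
  exists u v : bool, P (a (u + i)%N (v + j)%N) (b (u + i)%N (v + j)%N).

(* Sperner's lemma on a square grid. *)
Lemma sperner_grid : exists i j, [/\ (i < n)%N, (j < n)%N,
  vertices01 i j (fun a _ => ~~ a), vertices01 i j (fun a b => a && ~~ b) &
  vertices01 i j (fun a b => a && b)].
Proof.
apply: contrapT => nocell.
(* Around a cell that misses label 2 the labels 0 and 1 alternate an even number of times, and
   without label 0 or label 1 there is no such edge at all. Hence bottom and right edges have the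
   parity of top and left edges. *)
have cell i j : (i < n)%N -> (j < n)%N ->
    edge01 i j i.+1 j (+) edge01 i.+1 j i.+1 j.+1 =
    edge01 i j.+1 i.+1 j.+1 (+) edge01 i j i j.+1.
  move=> ilt jlt.
  have vE (P : bool -> bool -> bool) : vertices01 i j P <->
      [|| P (a i j) (b i j), P (a i.+1 j) (b i.+1 j),
          P (a i j.+1) (b i j.+1) | P (a i.+1 j.+1) (b i.+1 j.+1)].
    split; first by move=> [[] [[]]] /= ->; rewrite ?orbT.
    case/or4P => h.
    - by exists false, false.
    - by exists true, false.
    - by exists false, true.
    - by exists true, true.
  have {nocell} : ~ [/\ [|| ~~ a i j, ~~ a i.+1 j, ~~ a i j.+1 | ~~ a i.+1 j.+1],
      [|| a i j && ~~ b i j, a i.+1 j && ~~ b i.+1 j, a i j.+1 && ~~ b i j.+1 |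
          a i.+1 j.+1 && ~~ b i.+1 j.+1] &
      [|| a i j && b i j, a i.+1 j && b i.+1 j, a i j.+1 && b i j.+1 |
          a i.+1 j.+1 && b i.+1 j.+1]].
    case=> h0 h1 h2; apply: nocell; exists i, j; split => //.
    - exact: (vE (fun a _ => ~~ a)).2.
    - exact: (vE (fun a b => a && ~~ b)).2.
    - exact: (vE (fun a b => a && b)).2.
  rewrite /edge01; move: (a i j) (a i.+1 j) (a i j.+1) (a i.+1 j.+1).
  move: (b i j) (b i.+1 j) (b i j.+1) (b i.+1 j.+1).
  by do 8! case; move=> //= h; exfalso; apply: h; split.
pose row k j := \big[addb/false]_(i < k) edge01 i j i.+1 j.
(* Summed over a strip of cells, the inner vertical edges cancel. The left side carries only label 0
   and the right side never does, so neither contributes. *)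
have row_step j : (j < n)%N -> row n j = row n j.+1.
  move=> jlt.
  have main k : (k <= n)%N -> row k j (+) edge01 k j k j.+1 =
                 row k j.+1 (+) edge01 0%N j 0%N j.+1.
    elim: k => [_|k IH klt]; first by rewrite /row !big_ord0.
    rewrite /row !big_ord_recr /= -/(row k j) -/(row k j.+1).
    rewrite -addbA cell// [_ (+) edge01 k j k j.+1]addbC addbA IH ?(ltnW klt)//.
    by rewrite -!addbA; congr (_ (+) _); rewrite addbC.
  have := main n (leqnn n).
  by rewrite /edge01 !a_right (negbTE (a_left j)) (negbTE (a_left j.+1)) /= !addbF.
have row_const j : (j <= n)%N -> row n 0%N = row n j.
  by elim: j => // j IH jlt; rewrite -row_step// IH// ltnW.
(* Label 1 is absent from the top row, whose parity is therefore even. The bottom row has only the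
   labels 0 and 1 and starts and ends differently, so its parity is odd. *)
have := row_const n (leqnn n); rewrite [RHS]big1; last first.
  by move=> i _; rewrite /edge01 !b_top /= !andbF.
suff -> k : row k 0%N = a 0%N 0%N (+) a k 0%N by rewrite (negbTE (a_left _)) a_right.
rewrite /row; elim: k => [|k IH]; first by rewrite big_ord0 addbb.
rewrite big_ord_recr /= IH /edge01 (negbTE (b_bottom k)) (negbTE (b_bottom k.+1)).
by case: (a 0%N 0%N); case: (a k 0%N); case: (a k.+1 0%N).
Qed.

End GridSearch.

Lemma fmap_ultra (T V : Type) (f : T -> V) (F : set_system T) :
  UltraFilter F -> UltraFilter (f @ F).
Proof.
move=> FU; have FP := @ultra_proper _ _ FU; split; first exact: fmap_proper_filter.
move=> G GP sFG; rewrite predeqE => A; split; last exact: sFG.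
move=> GA; have [//|FnA] := in_ultra_setVsetC (f @^-1` A) FU.
have GnA : G (~` A) by apply: sFG.
by have [? []] := filter_ex (filterI GA GnA).
Qed.

Section UltraNat.
Context {R : realType}.
Variable U : set_system nat.
Hypothesis (UU : UltraFilter U).

Let PU : ProperFilter U. Proof. exact: ultra_proper. Qed.

(** Bolzano-Weierstrass without extraction: the filter does not depend on the sequence. *)
Lemma ultra_bounded_cvg (u : nat -> R) (x y : R) :
  (forall n, u n \in `[x, y]) -> exists2 l, l \in `[x, y] & u @ U --> l.
Proof.
move=> uxy; have := @segment_compact R x y; rewrite compact_ultra.
case/(_ (u @ U)).
- exact: fmap_ultra.
- by apply: (@filterE _ U) => n /=; rewrite uxy.
- by move=> l [lxy ul]; exists l.
Qed.

(* A uniform statement along a filter follows by testing it on selections. *)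
Lemma near_forall_selection (T : Type) (D Q : nat -> set T) :
  (forall n, D n !=set0) ->
  (forall s : nat -> T, (forall n, D n (s n)) -> \forall n \near U, Q n (s n)) ->
  \forall n \near U, forall s, D n s -> Q n s.
Proof.
move=> D0 h.
(* [s n] is a counterexample to [Q n] whenever there is one. *)
have /choice[s hs] n : exists s, D n s /\ (forall s', D n s' -> Q n s -> Q n s').
  have [[s' [Ds' nQs']]|nex] := pselect (exists s', D n s' /\ ~ Q n s').
    by exists s'; split => // s'' _ /nQs'.
  have [s0 Ds0] := D0 n; exists s0; split => // s' Ds' _.
  by apply: contrapT => nQ; apply: nex; exists s'.
have : \forall n \near U, Q n (s n) by apply: h => n; exact: (hs n).1.
by apply: filterS => n Qn s' Ds'; exact: (hs n).2 Qn.
Qed.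

End UltraNat.

Lemma ex_ultra_nat : exists2 U : set_system nat, UltraFilter U & \oo `<=` U.
Proof. by have [U [UU sU]] := ultraFilterLemma (eventually_filter); exists U. Qed.

Lemma cvg_shrink {R : realType} (U : set_system nat) (UU : ProperFilter U)
    (q c : nat -> R) (l C : R) : \oo `<=` U -> q @ U --> l ->
  (forall n, `|q n - c n| <= C / n.+1%:R) -> c @ U --> l.
Proof.
move=> sU ql qc.
have h : (fun n => C / n.+1%:R) @ U --> (0 : R).
  apply: cvg_trans (_ : (fun n => C / n.+1%:R) @ \oo --> (0 : R)).
    by move=> A; exact: sU.
  rewrite -(mulr0 C); apply: cvgMr; exact: cvg_harmonic.
have h0 : (fun n => q n - c n) @ U --> (0 : R).
  apply/cvgrPdist_le => e e0; move/cvgrPdist_le : h => /(_ _ e0).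
  apply: filterS => n; rewrite !sub0r !normrN; apply: le_trans.
  by rewrite (le_trans (qc n))// ler_norm.
have -> : c = (fun n => q n - (q n - c n)) by apply/funext => n; rewrite subKr.
by rewrite -[l]subr0; apply: cvgB.
Qed.

(** The labels record the signs of [T1 p - p.1] and [T2 p - p.2] on a grid of the square [-N, N]^2.
    Cells with all three labels shrink to a point, where by continuity the four inequalities carried
    by their corners hold together and become two equations. *)
Lemma brouwer_plane {R : realType} (T1 T2 : R * R -> R) (M : R) :
  continuous T1 -> continuous T2 -> (forall p, `|T1 p| <= M) ->
  (forall p, `|T2 p| <= M) -> exists p, T1 p = p.1 /\ T2 p = p.2.
Proof.
move=> cT1 cT2 T1M T2M; have [U UU sU] := ex_ultra_nat.
have PU := @ultra_proper _ _ UU.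
have M0 : 0 <= M by rewrite (le_trans _ (T1M (0, 0))).
(* The margin 1 makes [(T1, T2)] point strictly inwards on the sides of the square; the left and
   bottom conditions of [sperner_grid] are strict inequalities. *)
pose N := M + 1; pose x n i : R := - N + (2 * N) / n.+1%:R * i%:R.
have x_end n : x n n.+1 = N by rewrite /x divfK ?pnatr_eq0//; lra.
have x_0 n : x n 0%N = - N by rewrite /x mulr0 addr0.
have x_in n i : (i < n.+1)%N -> x n i \in `[- N, N].
  move=> ilt.
  have C0 : 0 <= (2 * N) / n.+1%:R by rewrite divr_ge0 ?ler0n//; rewrite /N; lra.
  rewrite in_itv /= {1}/x lerDl mulr_ge0//=.
  rewrite -[leRHS](x_end n) /x lerD2l.
  by apply: ler_wpM2l => //; rewrite ler_nat ltnW.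
have T1b p : - N < T1 p < N by move: (T1M p); rewrite ler_norml /N; lra.
have T2b p : - N < T2 p < N by move: (T2M p); rewrite ler_norml /N; lra.
pose near_pt n (q c : R * R) := `|q.1 - c.1| <= (2 * N) / n.+1%:R /\
   `|q.2 - c.2| <= (2 * N) / n.+1%:R.
(* [q] is the lower left corner of a cell with all labels and [ck] a corner with label [k]. The
   first inequality at [c2] is dropped, since [c1] already supplies it. *)
have /choice[s hs] n : exists z : (R * R) * ((R * R) * ((R * R) * (R * R))),
  let: (q, (c0, (c1, c2))) := z in
  [/\ q.1 \in `[- N, N] /\ q.2 \in `[- N, N],
     [/\ near_pt n q c0, near_pt n q c1 & near_pt n q c2],
     c0.1 <= T1 c0, T1 c1 <= c1.1 /\ c1.2 <= T2 c1 & T2 c2 <= c2.2].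
  have [||||i [j [ilt jlt]]] := @sperner_grid
      (fun i j => T1 (x n i, x n j) <= x n i) (fun i j => T2 (x n i, x n j) <= x n j) n.+1.
  - by move=> j; rewrite -ltNge x_0; case/andP: (T1b (- N, x n j)).
  - by move=> j; rewrite x_end ltW//; case/andP: (T1b (N, x n j)).
  - by move=> i; rewrite -ltNge x_0; case/andP: (T2b (x n i, - N)).
  - by move=> i; rewrite x_end ltW//; case/andP: (T2b (x n i, N)).
  move=> [u0 [v0 /=]]; rewrite -ltNge => h0.
  move=> [u1 [v1 /=]]; rewrite -ltNge => /andP[h1 h1'].
  move=> [u2 [v2 /=]] /andP[_ h2].
  exists ((x n i, x n j), ((x n (u0 + i)%N, x n (v0 + j)%N),
    ((x n (u1 + i)%N, x n (v1 + j)%N), (x n (u2 + i)%N, x n (v2 + j)%N)))).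
  have nr (u : bool) k : `|x n k - x n (u + k)%N| <= 2 * N / n.+1%:R.
    have -> : x n k - x n (u + k)%N = - (2 * N / n.+1%:R * u%:R).
      by rewrite /x natrD; ring.
    have C0 : 0 <= 2 * N / n.+1%:R by rewrite divr_ge0 ?ler0n//; rewrite /N; lra.
    by case: u; rewrite ?mulr1 ?mulr0 normrN ?ger0_norm.
  split => //=.
  - by rewrite !x_in.
  - by split; split; exact: nr.
  - exact: ltW.
  - by split=> //; exact: ltW.
have [l1 _ ql1] := @ultra_bounded_cvg R U UU (fun n => (s n).1.1) (- N) N
   (fun n => ltac:(by have := hs n; case: (s n) => q [c0 [c1 c2]] [[]])).
have [l2 _ ql2] := @ultra_bounded_cvg R U UU (fun n => (s n).1.2) (- N) N
   (fun n => ltac:(by have := hs n; case: (s n) => q [c0 [c1 c2]] [[]])).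
have cl (c : nat -> R * R) : (forall n, near_pt n (s n).1 (c n)) -> c @ U --> (l1, l2).
  move=> nc.
  have -> : c = (fun n => ((c n).1, (c n).2)) by apply/funext => n; case: (c n).
  apply: (@cvg_pair _ _ _ U (nbhs l1) (nbhs l2) _ _ _ (fun n => (c n).1) (fun n => (c n).2)).
    by apply: (@cvg_shrink R U PU _ _ _ _ sU ql1) => n; exact: (nc n).1.
  by apply: (@cvg_shrink R U PU _ _ _ _ sU ql2) => n; exact: (nc n).2.
have [c0l c1l c2l] : [/\ (fun n => (s n).2.1) @ U --> (l1, l2),
    (fun n => (s n).2.2.1) @ U --> (l1, l2) & (fun n => (s n).2.2.2) @ U --> (l1, l2)].
  by split; apply: cl => n; have := hs n; case: (s n) => q [c0 [c1 c2]] [_ []].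
have le_l (F G : R * R -> R) c : continuous F -> continuous G ->
    c @ U --> (l1, l2) -> (forall n, F (c n) <= G (c n)) -> F (l1, l2) <= G (l1, l2).
  move=> cF cG ccl FG; apply: (@ler_cvg_to nat U PU R (F \o c) (G \o c)).
  - by apply: continuous_cvg; [exact: cF|].
  - by apply: continuous_cvg; [exact: cG|].
  - by apply: filterE.
have c1 : continuous (fst : R * R -> R) by move=> p; exact: cvg_fst.
have c2 : continuous (snd : R * R -> R) by move=> p; exact: cvg_snd.
exists (l1, l2); split; apply/eqP; rewrite eq_le; apply/andP; split.
- by apply: (le_l _ _ _ cT1 c1 c1l) => n; have := hs n; case: (s n) => q [c0 [? ?]] [? ? ? []].
- by apply: (le_l _ _ _ c1 cT1 c0l) => n; have := hs n; case: (s n) => q [c0 [? ?]] [].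
- by apply: (le_l _ _ _ cT2 c2 c2l) => n; have := hs n; case: (s n) => q [c0 [? ?]] [].
- by apply: (le_l _ _ _ c2 cT2 c1l) => n; have := hs n; case: (s n) => q [c0 [? ?]] [? ? ? []].
Qed.

(** * Integration by substitution *)

Section Substitution.
Context {R : realType}.
Notation mu := (@lebesgue_measure R).

(** [D] may be unbounded and the integrands may blow up at its ends. The substitution is made on the
    compact intervals [[a n, b n]], and monotone convergence, available because everything is
    nonnegative, passes to their union. *)
Lemma ge0_integration_by_substitution_exhaustion (F f G : R -> R) (D : set R)
    (a b : nat -> R) :
  nonincreasing_seq a -> nondecreasing_seq b -> (forall n, a n < b n) ->
  D = \bigcup_n `[a n, b n]%classic ->
  (forall x y, D x -> D y -> x < y -> F x < F y) ->
  (forall x, D x -> is_derive x 1 F (f x)) ->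
  (forall x, D x -> {for x, continuous f}) ->
  (forall x, D x -> {for F x, continuous G}) ->
  (forall x, D x -> 0 <= f x) -> (forall x, D x -> 0 <= G (F x)) ->
  (\int[mu]_(y in F @` D) (G y)%:E = \int[mu]_(x in D) (G (F x) * f x)%:E)%E.
Proof.
move=> a_dec b_inc ab DE F_inc dF cf cG f0 G0.
have Dab n x : x \in `[a n, b n] -> D x by move=> xab; rewrite DE; exists n.
have Da n : D (a n) by apply: (Dab n); rewrite in_itv/= lexx ltW.
have Db n : D (b n) by apply: (Dab n); rewrite in_itv/= lexx ltW.
have cF x : D x -> {for x, continuous F}.
  by move=> /dF ?; apply/differentiable_continuous/derivable1_diffP/ex_derive.
have F_le x y : D x -> D y -> x <= y -> F x <= F y.
  by move=> Dx Dy; rewrite le_eqVlt => /predU1P[->//|/(F_inc _ _ Dx Dy)/ltW].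
have wcF n : {within `[a n, b n], continuous F}.
  by apply: continuous_in_subspaceT => x /set_mem /Dab /cF.
have surj n y : y \in `[F (a n), F (b n)] -> exists2 x, D x & F x = y.
  move=> yF; have [|x xab <-] := @IVT R F (a n) (b n) y (ltW (ab n)) (wcF n).
    have le_F : F (a n) <= F (b n) by apply: F_le => //; exact: ltW.
    by move: yF; rewrite in_itv/= (min_idPl le_F) (max_idPr le_F).
  by exists x => //; exact: Dab xab.
have EE : F @` D = \bigcup_n `[F (a n), F (b n)]%classic.
  rewrite eqEsubset; split => [_ [x Dx <-]|y [n _ /= /surj[x Dx <-]]]; last by exists x.
  move: (Dx); rewrite {1}DE => -[n _ /=]; rewrite in_itv/= => /andP[ax xb].
  by exists n => //=; rewrite in_itv/= !F_le.
have wcG n : {within `[F (a n), F (b n)], continuous G}.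
  by apply: continuous_in_subspaceT => y /set_mem /surj[x Dx <-]; exact: cG.
have wcGF n : {within `[a n, b n], continuous (fun x => G (F x) * f x)}.
  apply: continuous_in_subspaceT => x /set_mem /Dab Dx.
  apply: continuousM; last exact: cf.
  by apply: continuous_comp; [exact: cF|exact: cG].
have step n : (\int[mu]_(y in `[F (a n), F (b n)]) (G y)%:E =
    \int[mu]_(x in `[a n, b n]) (G (F x) * f x)%:E)%E.
  rewrite (@integration_by_substitution_increasing _ F G _ _ (ltW (ab n))).
  - apply: eq_integral => x; rewrite inE /= => /Dab /dF dFx.
    suff <- : derive1 F x = f x by [].
    by rewrite derive1E (@derive_val _ _ _ _ _ _ _ dFx).
  - by move=> x y /Dab Dx /Dab Dy; exact: F_inc.
  - move=> x xab; have Dx : D x by apply: (Dab n); exact: subset_itv_oo_cc xab.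
    have nr : \forall z \near x, f z = derive1 F z.
      have := near_in_itvoo xab; apply: filterS => z /subset_itv_oo_cc /Dab /dF dFz.
      by rewrite derive1E (@derive_val _ _ _ _ _ _ _ dFz).
    rewrite /continuous_at -(nbhs_singleton nr).
    by apply: cvg_trans (cf _ Dx); apply: near_eq_cvg.
  - apply/cvg_ex; exists (f (a n)).
    have /cvg_at_right_filter h := cf _ (Da n); apply: cvg_trans h.
    apply: near_eq_cvg; near=> z; rewrite derive1E.
    have /Dab /dF dFz : z \in `[a n, b n] by rewrite in_itv/=; apply/andP; split; near: z;
      [exact: nbhs_right_ge|exact: nbhs_right_le].
    by rewrite (@derive_val _ _ _ _ _ _ _ dFz).
  - apply/cvg_ex; exists (f (b n)).
    have /cvg_at_left_filter h := cf _ (Db n); apply: cvg_trans h.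
    apply: near_eq_cvg; near=> z; rewrite derive1E.
    have /Dab /dF dFz : z \in `[a n, b n] by rewrite in_itv/=; apply/andP; split; near: z;
      [exact: nbhs_left_ge|exact: nbhs_left_le].
    by rewrite (@derive_val _ _ _ _ _ _ _ dFz).
  - split; [|exact/cvg_at_right_filter/cF|exact/cvg_at_left_filter/cF].
    by move=> x /subset_itv_oo_cc /Dab /dF ?; exact: ex_derive.
  - exact: wcG.
have itv_mono (u v : nat -> R) : nonincreasing_seq u -> nondecreasing_seq v ->
    nondecreasing_seq (fun n => `[u n, v n]%classic).
  move=> u_dec v_inc m n mn; rewrite subsetEset => x /=; rewrite !in_itv/=.
  by move=> /andP[ux xv]; rewrite (le_trans (u_dec _ _ mn) ux) (le_trans xv (v_inc _ _ mn)).
have lhs := @ge0_nondecreasing_set_cvg_integral _ (measurableTypeR R) R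
   (fun n => `[F (a n), F (b n)]%classic) (EFin \o G) (@lebesgue_measure R).
have rhs := @ge0_nondecreasing_set_cvg_integral _ (measurableTypeR R) R
   (fun n => `[a n, b n]%classic) (fun x => (G (F x) * f x)%:E) (@lebesgue_measure R).
have {}lhs := lhs (itv_mono _ _ (fun m n mn => F_le _ _ (Da n) (Da m) (a_dec _ _ mn))
  (fun m n mn => F_le _ _ (Db m) (Db n) (b_inc _ _ mn))) (fun n => measurable_itv _).
have {}rhs := rhs (itv_mono _ _ a_dec b_inc) (fun n => measurable_itv _).
rewrite EE [in RHS]DE; apply: (@cvg_unique _ _ (\int[mu]_(x in `[a n, b n]) (G (F x) * f x)%:E @[n --> \oo])%E).
- exact: ereal_hausdorff.
- apply: cvg_trans (lhs _ _).
  + by apply: near_eq_cvg; apply: filterE => n; exact: step.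
  + by move=> n; apply/measurable_EFinP; apply: subspace_continuous_measurable_fun => //; exact: wcG.
  + by move=> n _ /= /surj[x Dx <-]; rewrite lee_fin G0.
- apply: rhs.
  + by move=> n; apply/measurable_EFinP; apply: subspace_continuous_measurable_fun => //; exact: wcGF.
  + by move=> n x /Dab Dx; rewrite lee_fin mulr_ge0 ?G0 ?f0.
Unshelve. all: by end_near. Qed.

End Substitution.

(** * Euler integrals *)

Section PowerFunction.
Context {R : realType}.
Implicit Types x z : R.

Lemma is_derive_powR x z : 0 < x ->
  is_derive x 1 (fun t => t `^ z) (z * x `^ (z - 1)).
Proof.
move=> x0; have xI : x \in `]0, +oo[%R by rewrite in_itv/= x0.
rewrite -(powR_derive1 z xI) derive1E.
by apply: DeriveDef => //; exact: derivable_powR.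
Qed.

Lemma continuous_powR x z : 0 < x -> {for x, continuous (fun t => t `^ z)}.
Proof.
move=> /is_derive_powR - /(_ z) dx.
by apply/differentiable_continuous/derivable1_diffP/ex_derive.
Qed.

Lemma powRB1 x z : 0 < x -> x `^ (z - 1) * x = x `^ z.
Proof.
move=> x0; rewrite -[X in _ * X](powRr1 (ltW x0)) -powRD ?subrK//.
by rewrite (gt_eqF x0) implybT.
Qed.

Lemma powRD_gt0 x z z' : 0 < x -> x `^ (z + z') = x `^ z * x `^ z'.
Proof. by move=> x0; rewrite powRD// (gt_eqF x0) implybT. Qed.

End PowerFunction.

Section EulerIntegrals.
Context {R : realType}.
Local Notation mu := (@lebesgue_measure R).
Local Notation pos := (`]0%R, +oo[%classic : set R).
Implicit Types a b c x z : R.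

(** Values in [0, +oo] allow Tonelli's theorem before the integral is known to be finite. *)
Definition eGamma z : \bar R := (\int[mu]_(t in pos) (t `^ (z - 1) * expR (- t))%:E)%E.

(** The Beta function carried to the half-line by v = u / (1 - u). This is the form that both the
    product of two Gamma integrals and the kernel in [psi] lead to. *)
Definition eBeta a b : \bar R :=
  (\int[mu]_(v in pos) (v `^ (b - 1) * (1 + v) `^ (- (a + b)))%:E)%E.

Let posE x : pos x = (0 < x) :> Prop.
Proof. by rewrite /= in_itv/= andbT. Qed.

Let measurable_eGamma z c :
  measurable_fun setT (fun t => t `^ (z - 1) * expR (- (c * t))).
Proof.
apply: measurable_funM; first exact: measurable_powR.
apply: measurableT_comp; first exact: measurable_expR.
by apply: measurableT_comp => //; exact: measurable_funM.
Qed.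

Let measurable_eBeta a b :
  measurable_fun setT (fun v => v `^ (b - 1) * (1 + v) `^ (- (a + b))).
Proof.
apply: measurable_funM; first exact: measurable_powR.
by apply: (measurableT_comp (measurable_powR _)); exact: measurable_funD.
Qed.

Let mpos : measurable pos. Proof. exact: measurable_itv. Qed.

Let integral_posZ (k : R -> R) c : 0 <= c -> measurable_fun setT k ->
  (forall x, 0 < x -> 0 <= k x) ->
  (\int[mu]_(x in pos) (c * k x)%:E = c%:E * \int[mu]_(x in pos) (k x)%:E)%E.
Proof.
move=> c0 mk k0; under eq_integral do rewrite EFinM.
rewrite ge0_integralZl//.
  by apply/measurable_EFinP; exact: measurable_funTS.
by move=> x; rewrite posE => /k0; rewrite lee_fin.
Qed.

Let tonelli_pos (k : R -> R -> R) :
  measurable_fun setT (fun p : R * R => k p.1 p.2) ->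
  (forall x y, 0 < x -> 0 < y -> 0 <= k x y) ->
  (\int[mu]_(x in pos) \int[mu]_(y in pos) (k x y)%:E =
   \int[mu]_(y in pos) \int[mu]_(x in pos) (k x y)%:E)%E.
Proof.
move=> mk k0.
pose K (p : R * R) : \bar R := (k p.1 p.2 * (\1_pos p.1 * \1_pos p.2))%:E.
have Kxy x y : 0 < x -> ((fun y => (k x y)%:E) \_ pos) y = K (x, y).
  move=> x0; have xp : x \in pos by rewrite inE posE.
  by rewrite /K patchE/= !indicE xp; case: (y \in pos); rewrite ?(mulr1, mulr0).
have Kyx x y : 0 < y -> ((fun x => (k x y)%:E) \_ pos) x = K (x, y).
  move=> y0; have yp : y \in pos by rewrite inE posE.
  by rewrite /K patchE/= !indicE yp; case: (x \in pos); rewrite ?(mulr1, mulr0, mul0r).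
transitivity (\int[mu]_x \int[mu]_y K (x, y))%E.
  rewrite integral_mkcond; apply: eq_integral => x _; rewrite patchE.
  case: ifPn => [/set_mem|/negP xN].
    by rewrite posE => x0; rewrite integral_mkcond; apply: eq_integral => y _; exact: Kxy.
  rewrite integral0_eq// => y _; rewrite /K/= !indicE.
  by move/negP/negbTE: xN => ->; rewrite mul0r mulr0.
rewrite (@fubini_tonelli _ _ _ _ R mu mu K).
- rewrite [RHS]integral_mkcond; apply: eq_integral => y _; rewrite patchE.
  case: ifPn => [/set_mem|/negP yN].
    by rewrite posE => y0; rewrite [RHS]integral_mkcond; apply: eq_integral => x _; rewrite Kyx.
  rewrite integral0_eq// => x _; rewrite /K/= !indicE.
  by move/negP/negbTE: yN => ->; rewrite !mulr0.
- apply/measurable_EFinP; apply: measurable_funM => //; apply: measurable_funM.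
    by apply: measurableT_comp; [exact: measurable_indic|exact: measurable_fst].
  by apply: measurableT_comp; [exact: measurable_indic|exact: measurable_snd].
- move=> [x y]; rewrite /K lee_fin/= !indicE.
  case: (boolP (x \in pos)) => [/set_mem|_]; last by rewrite mul0r mulr0.
  case: (boolP (y \in pos)) => [/set_mem|_]; last by rewrite !mulr0.
  by rewrite !posE => y0 x0; rewrite !mulr1 k0.
Qed.

Lemma eGamma_ge0 z : (0 <= eGamma z)%E.
Proof. by apply: integral_ge0 => t _; rewrite lee_fin mulr_ge0 ?powR_ge0 ?expR_ge0. Qed.

Lemma eGamma_scale z c : 0 < c ->
  (eGamma z = (c `^ z)%:E * \int[mu]_(t in pos) (t `^ (z - 1) * expR (- (c * t)))%:E)%E.
Proof.
move=> c0; rewrite -integral_posZ ?powR_ge0//; last first.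
  by move=> t _; rewrite mulr_ge0 ?powR_ge0 ?expR_ge0.
rewrite /eGamma; have {1}-> : pos = ( *%R c) @` pos.
  rewrite eqEsubset; split => [y|_ [y + <-]]; rewrite !posE => y0; last by rewrite mulr_gt0.
  by exists (c^-1 * y); rewrite ?posE ?mulr_gt0 ?invr_gt0// mulrA divff ?mul1r// gt_eqF.
have dF x : pos x -> is_derive x 1 ( *%R c) (cst c x).
  by move=> _; apply: is_derive_eq; rewrite /cst /= ?mulr1 ?scaler1// /GRing.scale/= ?mulr1.
(* The right ends start at 2 because the first interval, with left end 1, must not be degenerate. *)
rewrite (@ge0_integration_by_substitution_exhaustion R ( *%R c) (cst c)
   (fun t => t `^ (z - 1) * expR (- t)) pos (fun n => n.+1%:R^-1) (fun n => n.+2%:R)).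
- apply: eq_integral => t /set_mem; rewrite posE => t0; congr EFin.
  by rewrite powRM ?ltW// -(powRB1 _ z c0)//=; ring.
- by move=> m n mn; rewrite lef_pV2 ?posrE ?ltr0n// ler_nat ltnS.
- by move=> m n mn; rewrite ler_nat !ltnS.
- move=> n; rewrite (@le_lt_trans _ _ 1) ?ltr1n//.
  by rewrite invf_le1 ?ltr0n// ler1n.
- rewrite eqEsubset; split => [x|x [n _ /=]]; last first.
    by rewrite !in_itv/= andbT => /andP[+ _]; apply: lt_le_trans; rewrite invr_gt0 ltr0n.
  rewrite posE => x0; pose n := (Num.truncn x + Num.truncn x^-1)%N.
  exists n => //=; rewrite in_itv/=; apply/andP; split.
    rewrite -[leRHS]invrK lef_pV2 ?posrE ?invr_gt0 ?ltr0n//.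
    rewrite ltW// (lt_le_trans (truncnS_gt _))// ler_nat ltnS.
    exact: leq_addl.
  rewrite ltW// (lt_le_trans (truncnS_gt _))// ler_nat ltnS.
  exact: (leq_trans (leq_addr _ _) (leqnSn _)).
- by move=> x y _ _; rewrite ltr_pM2l.
- by move=> x _; exact: cst_continuous.
- move=> x; rewrite posE => x0; apply: continuousM.
    by apply: continuous_powR; rewrite mulr_gt0.
  by apply: continuous_comp; [exact: continuousN|exact: continuous_expR].
- by move=> x _; exact: ltW.
- by move=> x _; rewrite mulr_ge0 ?powR_ge0 ?expR_ge0.
Qed.

(** [eGamma_scale] with factor [x] writes the second Gamma integral in the variable [v]; after the
    exchange, [eGamma_scale] with factor [1 + v] recognizes the integral in [x]. *)
Lemma eGammaM a b : (eGamma a * eGamma b = eGamma (a + b) * eBeta a b)%E.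
Proof.
pose k x v : R := x `^ (a + b - 1) * v `^ (b - 1) * expR (- (x * (1 + v))).
have mexp : measurable_fun setT (fun p : R * R => expR (- (p.1 * (1 + p.2)))).
  apply: measurableT_comp; first exact: measurable_expR.
  apply: measurableT_comp => //; apply: measurable_funM; first exact: measurable_fst.
  by apply: measurable_funD => //; exact: measurable_snd.
have k0 x v : 0 <= k x v by rewrite !mulr_ge0 ?powR_ge0 ?expR_ge0.
have mk : measurable_fun setT (fun p : R * R => k p.1 p.2).
  apply: measurable_funM => //; apply: measurable_funM.
    by apply: (measurableT_comp (measurable_powR _)); exact: measurable_fst.
  by apply: (measurableT_comp (measurable_powR _)); exact: measurable_snd.
transitivity (\int[mu]_(x in pos) \int[mu]_(v in pos) (k x v)%:E)%E.
  rewrite -ge0_integralZr ?eGamma_ge0//; last 2 first.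
  - apply/measurable_EFinP; apply: measurable_funTS.
    by apply: eq_measurable_fun (measurable_eGamma a 1) => x _; rewrite mul1r.
  - by move=> x _; rewrite lee_fin mulr_ge0 ?powR_ge0 ?expR_ge0.
  apply: eq_integral => x /set_mem; rewrite posE => x0.
  rewrite (eGamma_scale b x x0) muleA -EFinM -integral_posZ//.
  - apply: eq_integral => v _; congr EFin; rewrite /k mulrDr mulr1 opprD expRD.
    have -> : x `^ (a + b - 1) = x `^ (a - 1) * x `^ b.
      by rewrite -powRD_gt0//; congr powR; ring.
    by ring.
  - by rewrite !mulr_ge0 ?powR_ge0 ?expR_ge0.
  - by move=> v _; rewrite mulr_ge0 ?powR_ge0 ?expR_ge0.
rewrite tonelli_pos// muleC -ge0_integralZr ?eGamma_ge0//; last 2 first.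
- by apply/measurable_EFinP; apply: measurable_funTS; exact: measurable_eBeta.
- by move=> x _; rewrite lee_fin mulr_ge0 ?powR_ge0.
apply: eq_integral => v /set_mem; rewrite posE => v0.
have v1 : 0 < 1 + v by rewrite addr_gt0.
rewrite (eGamma_scale (a + b) (1 + v) v1) muleA -EFinM -integral_posZ//.
- apply: eq_integral => x _; congr EFin; rewrite /k powRN.
  rewrite divfK ?gt_eqF ?powR_gt0//  [x * _]mulrC; ring.
- by rewrite !mulr_ge0 ?powR_ge0.
- by move=> x _; rewrite mulr_ge0 ?powR_ge0 ?expR_ge0.
Qed.

(** Together with [eGammaM] and [eGamma1] this is the functional equation of Gamma, obtained without
    integrating by parts. *)
Lemma eBetar1 z : 0 < z -> eBeta z 1 = (z^-1)%:E.
Proof.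
move=> z0; have z_neq0 : z != 0 by rewrite gt_eqF.
pose F v : R := - z^-1 * (1 + v) `^ (- z).
have dF (v : R) : -1 < v -> is_derive v 1 F ((1 + v) `^ (- (z + 1))).
  move=> v1; have v1' : 0 < 1 + v by rewrite -ltrBlDl sub0r.
  have d2 : is_derive v 1 (fun t : R => 1 + t) (1 : R).
    have : is_derive v 1 (cst (1 : R) + id) (0 + 1 : R) by apply: is_deriveD.
    by rewrite add0r.
  have d := @is_derive1_comp R (fun t => t `^ (- z)) _ v _ _ (is_derive_powR (1 + v) (- z) v1') d2.
  have d' : is_derive v 1 F (- z^-1 *: (- z * (1 + v) `^ (- z - 1) * 1)) by exact: is_deriveZ.
  by apply: (is_derive_eq d'); rewrite /GRing.scale/= opprD; field.
have cf (v : R) : -1 < v -> {for v, continuous (fun v : R => (1 + v) `^ (- (z + 1)))}.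
  move=> v1; apply: (@continuous_comp _ _ _ (fun t : R => 1 + t) (fun t => t `^ (- (z + 1)))).
    by apply: continuousD; [exact: cst_continuous|exact: cvg_id].
  by apply: continuous_powR; rewrite -ltrBlDl sub0r.
have -> : eBeta z 1 = (\int[mu]_(v in `[0%R, +oo[) ((1 + v) `^ (- (z + 1)))%:E)%E.
  rewrite -integral_itv_obnd_cbnd; last first.
    apply/measurable_EFinP; apply: measurable_funTS.
    by apply: (measurableT_comp (measurable_powR _)); exact: measurable_funD.
  by apply: eq_integral => v _; rewrite subrr powRr0 mul1r.
have nonneg_gt (v : R) : 0 <= v -> -1 < v by apply: lt_le_trans; rewrite ltrN10.
rewrite (@ge0_continuous_FTC2y R _ F 0 0).
- by rewrite /F addr0 powR1 mulr1 sub0e -EFinN opprK.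
- by move=> v _; exact: powR_ge0.
- apply: continuous_in_subspaceT => v; rewrite inE/= in_itv/= andbT => v0.
  exact/cf/nonneg_gt.
- rewrite /F -(mulr0 (- z^-1)); apply: cvgMr; apply/cvgrPdist_le => e e0.
  near=> v; rewrite sub0r normrN ger0_norm ?powR_ge0// powRN.
  have v0 : 0 <= v by near: v; exact: nbhs_pinfty_ge.
  rewrite -[leRHS]invrK lef_pV2 ?posrE ?powR_gt0 ?invr_gt0//; last by rewrite ltr_wpDr.
  have -> : e^-1 = (e^-1 `^ z^-1) `^ z.
    by rewrite -powRrM mulVf// powRr1// invr_ge0 ltW.
  apply: ge0_ler_powR; rewrite ?nnegrE ?powR_ge0 ?addr_ge0 ?(ltW z0)//.
  apply: (@le_trans _ _ v); last by rewrite lerDr.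
  by near: v; apply: nbhs_pinfty_ge; rewrite num_real.
- by move=> v v0; have := dF v (nonneg_gt _ (ltW v0)) => ?; exact: ex_derive.
- apply/cvg_at_right_filter; have := dF 0 (nonneg_gt _ (lexx _)) => ?.
  by apply/differentiable_continuous/derivable1_diffP/ex_derive.
- move=> v; rewrite in_itv/= andbT => v0; rewrite derive1E.
  by have := dF v (nonneg_gt _ (ltW v0)) => ?; rewrite derive_val.
Unshelve. all: by end_near. Qed.

Lemma eGamma1 : eGamma 1 = 1%E.
Proof.
rewrite -(@integral_exponential_pdf R 1)// /exponential_pdf.
transitivity (\int[mu]_(t in `[0%R, +oo[) (1 * expR (- 1 * t))%:E)%E; last first.
  rewrite integral_mkcond; apply: eq_integral => t _.
  by rewrite !patchE; case: ifPn.
rewrite -integral_itv_obnd_cbnd; last first.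
  apply/measurable_EFinP; apply: measurable_funTS; apply: measurable_funM => //.
  by apply: measurableT_comp; [exact: measurable_expR|exact: measurable_funM].
by apply: eq_integral => t _; rewrite subrr powRr0 !mul1r mulN1r.
Qed.

Let eGammaS z : 0 < z -> (eGamma z = eGamma (z + 1) * (z^-1)%:E)%E.
Proof. by move=> z0; rewrite -eBetar1// -eGammaM eGamma1 mule1. Qed.

(** For x in [1, 2] one has t^(x - 1) <= 1 + t, so the integral is at most Gamma(1) + Gamma(2). The
    functional equation then reaches ]0, 1[ in one step and larger arguments by induction. *)
Lemma eGamma_fin_num z : 0 < z -> eGamma z \is a fin_num.
Proof.
have G2 : eGamma 2 = 1%E.
  by have := eGammaS 1 ltr01; rewrite eGamma1 invr1 mule1.
have G12 x : 1 <= x <= 2 -> eGamma x \is a fin_num.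
  move=> /andP[x1 x2]; rewrite ge0_fin_numE ?eGamma_ge0//.
  apply: (@le_lt_trans _ _ (eGamma 1 + eGamma 2)%E); last by rewrite eGamma1 G2 ltry.
  have mG w : measurable_fun pos (fun t : R => (t `^ (w - 1) * expR (- t))%:E).
    apply/measurable_EFinP; apply: measurable_funTS.
    by apply: eq_measurable_fun (measurable_eGamma w 1) => t _; rewrite mul1r.
  have G0 w t : (0 <= (t `^ (w - 1) * expR (- t) : R)%:E)%E.
    by rewrite lee_fin mulr_ge0 ?powR_ge0 ?expR_ge0.
  rewrite /eGamma -(ge0_integralD mu mpos (fun t _ => G0 1 t) (mG 1) (fun t _ => G0 2 t) (mG 2)).
  apply: ge0_le_integral => //; first exact: mG.
    by apply: emeasurable_funD; exact: mG.
  move=> t; rewrite posE => t0; rewrite -EFinD lee_fin -mulrDl ler_pM2r ?expR_gt0//.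
  rewrite subrr powRr0 (_ : 2 - 1 = 1); last by lra.
  rewrite powRr1 ?(ltW t0)//; have [t1|t1] := leP t 1.
    rewrite (@le_trans _ _ 1)//; last by rewrite lerDl ltW.
    by rewrite -[leRHS](powRr0 t); apply: ger_powR; rewrite ?t0//; lra.
  rewrite (@le_trans _ _ t)//; last by rewrite lerDr.
  by rewrite -[leRHS]powRr1 ?(ltW t0)//; apply: ler_powR; [exact: ltW|lra].
have G n x : 0 < x <= n.+2%:R -> eGamma x \is a fin_num.
  elim: n x => [|n IH] x /andP[x0 xn].
    have [x1|x1] := leP 1 x; first by rewrite G12 ?x1.
    by rewrite eGammaS// fin_numM// G12//; apply/andP; split; lra.
  have [x2|x2] := leP x 2; first by apply: (IH); rewrite x0 (le_trans x2)// ler_nat.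
  have x10 : 0 < x - 1 by lra.
  have : eGamma (x - 1) \is a fin_num.
    by apply: IH; rewrite x10/= lerBlDr -natr1 in xn *.
  rewrite eGammaS// subrK !ge0_fin_numE ?mule_ge0 ?eGamma_ge0 ?lee_fin ?invr_ge0 ?(ltW x10)//.
  case E : (eGamma x) => [r| |]; rewrite ?ltry//.
  by rewrite gt0_mulye// lte_fin invr_gt0.
move=> z0; apply: (G (Num.truncn z)); rewrite z0/= ltW//.
by rewrite (lt_le_trans (truncnS_gt _))// ler_nat.
Qed.

Lemma eGammaE z : 0 < z -> eGamma z = (Gamma z)%:E.
Proof. by move=> z0; rewrite -(fineK (eGamma_fin_num z z0)). Qed.

Lemma GammaS z : 0 < z -> Gamma (z + 1) = z * Gamma z.
Proof.
move=> z0; have := eGammaS z z0; rewrite !eGammaE ?addr_gt0// -EFinM => -[->].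
by rewrite mulrCA mulfV ?mulr1// gt_eqF.
Qed.

Lemma Gamma3 : Gamma (3 : R) = 2.
Proof.
have G1 : Gamma (1 : R) = 1 by apply: EFin_inj; rewrite -eGammaE// eGamma1.
by rewrite (_ : 3 = 1 + 1 + 1 :> R) ?GammaS// ?G1; lra.
Qed.

(** For an argument at least 1 the integrand is at least exp(-2) on [1, 2]; the functional equation
    covers the smaller arguments. *)
Lemma Gamma_gt0 z : 0 < z -> 0 < Gamma z.
Proof.
move=> z0; suff G x : 1 <= x -> 0 < Gamma x.
  by rewrite -(pmulr_rgt0 _ z0) -GammaS// G// lerDr ltW.
move=> x1; have x0 : 0 < x by exact: lt_le_trans x1.
rewrite -lte_fin -eGammaE//; apply: (@lt_le_trans _ _ (expR (- 2))%:E).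
  by rewrite lte_fin expR_gt0.
have mG : measurable_fun pos (fun t : R => (t `^ (x - 1) * expR (- t))%:E).
  apply/measurable_EFinP; apply: measurable_funTS.
  by apply: eq_measurable_fun (measurable_eGamma x 1) => t _; rewrite mul1r.
have sub : `[1, 2]%classic `<=` pos.
  move=> t; rewrite posE /= in_itv/= => /andP[t1 _]; exact: lt_le_trans t1.
apply: (@le_trans _ _ (\int[mu]_(t in `[1%R, 2%R]) (t `^ (x - 1) * expR (- t))%:E)%E); last first.
  apply: ge0_subset_integral => // t _.
  by rewrite lee_fin mulr_ge0 ?powR_ge0 ?expR_ge0.
have -> : (expR (- 2))%:E = (\int[mu]_(t in `[1%R, 2%R]) cst (expR (- 2))%:E t)%E.
  rewrite integral_cst//= lebesgue_measure_itv/= lte_fin ltr1n -EFinB.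
  by rewrite -EFinM (_ : 2 - 1 = 1 :> R) ?mulr1//; lra.
apply: ge0_le_integral => //.
- by move=> t _; rewrite lee_fin expR_ge0.
- exact: measurable_funS mG.
- move=> t /=; rewrite in_itv/= => /andP[t1 t2]; rewrite lee_fin -[leLHS]mul1r.
  apply: ler_pM; rewrite ?expR_ge0//.
    by rewrite -[leLHS](powRr0 t); apply: ler_powR => //; lra.
  by rewrite ler_expR lerN2.
Qed.

End EulerIntegrals.

(** * Derivatives on the unit interval *)

Section UnitIntervalCalculus.
Context {R : realType}.
Implicit Types (h k : R -> R) (t l : R).

Definition is_deriv01 h t l := diffquot01 h t @ within `[0, 1] t^' --> l.

Lemma within01_dnbhs_proper t : t \in `[0, 1] -> ProperFilter (within `[0, 1] t^').
Proof.
rewrite in_itv/= => /andP[t0 t1]; apply: Build_ProperFilter_ex => A.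
rewrite /within/= /dnbhs /within/= => -[e /= e0 eA].
(* A step of length below 1/2 towards the middle never leaves [0, 1]. Properness is what makes
   [deriv01], a limit, well determined. *)
pose d := Num.min e 2^-1 / 2; have d0 : 0 < d by rewrite divr_gt0 ?lt_min ?e0 ?invr_gt0 ?ltr0n.
have [de d2] : d < e /\ d < 2^-1.
  have [m1 m2] : Num.min e 2^-1 <= e /\ Num.min e 2^-1 <= 2^-1.
    by rewrite !ge_min !lexx orbT.
  by move: d0; rewrite /d; lra.
have [th|th] := leP t 2^-1.
  exists (t + d); apply: eA => /=.
  - by rewrite opprD addrA subrr sub0r normrN ger0_norm ?ltW.
  - by rewrite gt_eqF// ltrDl.
  - by rewrite in_itv/=; apply/andP; split; lra.
exists (t - d); apply: eA => /=.
- by rewrite opprB addrC subrK ger0_norm ?ltW.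
- by rewrite lt_eqF// gtrBl.
- by rewrite in_itv/=; apply/andP; split; lra.
Qed.

Lemma is_deriv01E h t l : t \in `[0, 1] -> is_deriv01 h t l -> deriv01 h t = l.
Proof. by move=> /within01_dnbhs_proper ?; exact: cvg_lim. Qed.

Lemma is_deriv01_derivable01 h t l : is_deriv01 h t l -> derivable01 h t.
Proof. by move=> hl; apply/cvg_ex; exists l. Qed.

Lemma derivable01P h t : derivable01 h t -> is_deriv01 h t (deriv01 h t).
Proof. by []. Qed.

(** With the quotient cleared here and in [is_derive_epsP], the derivative on [0, 1] and the usual
    one differ only in the range of [s]. *)
Lemma is_deriv01P h t l : is_deriv01 h t l <->
  forall e, 0 < e -> exists2 d, 0 < d &
    forall s, s \in `[0, 1] -> `|s - t| < d -> `|h s - h t - l * (s - t)| <= e * `|s - t|.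
Proof.
have quot s : s != t -> l - diffquot01 h t s = - (h s - h t - l * (s - t)) / (s - t).
  by move=> st; rewrite /diffquot01; field; rewrite subr_eq0.
split=> [/cvgrPdist_le hl e e0|hl].
  have [d /= d0 hd] := hl e e0; exists d => // s s01 sd.
  have [->|st] := eqVneq s t; first by rewrite !subrr mulr0 subrr normr0 mulr0.
  have /= := hd s; rewrite distrC sd => /(_ isT st s01).
  by rewrite quot// normrM normrN normfV ler_pdivrMr// normr_gt0 subr_eq0.
apply/cvgrPdist_le => e e0; have [d d0 hd] := hl e e0.
exists d => //= s sd st s01.
rewrite quot// normrM normrN normfV ler_pdivrMr ?normr_gt0 ?subr_eq0//.
by apply: hd => //; rewrite distrC.
Qed.

Lemma is_derive_epsP h t l : is_derive t 1 h l <->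
  forall e, 0 < e -> exists2 d, 0 < d &
    forall s, `|s - t| < d -> `|h s - h t - l * (s - t)| <= e * `|s - t|.
Proof.
pose q (u : R) : R := u^-1 *: ((h \o shift t) (u *: 1) - h t).
have qE s : s != t -> l - q (s - t) = - (h s - h t - l * (s - t)) / (s - t).
  move=> st; rewrite /q /= /GRing.scale/= mulr1 subrK.
  by field; rewrite subr_eq0.
split=> [[dh hl]|hl].
  have /cvgrPdist_le ql : q @ 0^' --> l by rewrite -hl.
  move=> e /ql[d /= d0 hd]; exists d => // s sd.
  have [->|st] := eqVneq s t; first by rewrite !subrr mulr0 subrr normr0 mulr0.
  have sd' : `|0 - (s - t)| < d by rewrite sub0r normrN.
  have st0 : s - t != 0 by rewrite subr_eq0.
  have := hd (s - t) sd' st0.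
  by rewrite qE// normrM normrN normfV ler_pdivrMr// normr_gt0 subr_eq0.
have ql : q @ 0^' --> l.
  apply/cvgrPdist_le => e /hl[d d0 hd]; exists d => //= u ud' u0.
  have ud : `|u| < d by have : `|0 - u| < d := ud'; rewrite sub0r normrN.
  have ut : u + t != t by rewrite -subr_eq0 addrK.
  have := qE _ ut; rewrite addrK => ->; rewrite normrM normrN normfV ler_pdivrMr ?normr_gt0//.
  by have := hd (u + t); rewrite addrK => ->.
by apply: DeriveDef; [apply/cvg_ex; exists l|exact: cvg_lim].
Qed.

Lemma is_derive_is_deriv01 h t l : is_derive t 1 h l -> is_deriv01 h t l.
Proof.
move=> /is_derive_epsP hl; apply/is_deriv01P => e /hl[d d0 hd].
by exists d => // s _; exact: hd.
Qed.

Lemma is_deriv01_is_derive h t l : t \in `]0, 1[ -> is_deriv01 h t l -> is_derive t 1 h l.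
Proof.
rewrite in_itv/= => /andP[t0 t1] /is_deriv01P hl; apply/is_derive_epsP => e /hl[d d0 hd].
exists (Num.min d (Num.min t (1 - t))); first by rewrite !lt_min d0 t0 subr_gt0.
move=> s; rewrite !lt_min => /and3P[sd st st1]; apply: hd => //.
by move: st st1; rewrite !ltr_norml in_itv/= => /andP[? ?] /andP[? ?]; apply/andP; split; lra.
Qed.

Lemma eq_is_deriv01 h k t l : {in `[0, 1], h =1 k} -> t \in `[0, 1] ->
  is_deriv01 h t l -> is_deriv01 k t l.
Proof.
move=> hk t01 /is_deriv01P hl; apply/is_deriv01P => e /hl[d d0 hd]; exists d => // s s01 sd.
by rewrite -!hk// hd.
Qed.

Lemma is_deriv01_locally_lipschitz h t l : is_deriv01 h t l -> exists2 d, 0 < d &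
  forall s, s \in `[0, 1] -> `|s - t| < d -> `|h s - h t| <= (`|l| + 1) * `|s - t|.
Proof.
move=> /is_deriv01P/(_ _ ltr01)[d d0 hd]; exists d => // s s01 sd.
rewrite -[h s - h t](subrK (l * (s - t))) (le_trans (ler_normD _ _))//.
by rewrite normrM mulrDl addrC lerD2l hd.
Qed.

Lemma is_deriv01B h k t l m : is_deriv01 h t l -> is_deriv01 k t m ->
  is_deriv01 (fun s => h s - k s) t (l - m).
Proof.
move=> hl km.
have : diffquot01 h t \- diffquot01 k t @ within `[0, 1] t^' --> l - m by apply: cvgB.
by apply: cvg_trans; apply: near_eq_cvg; apply: filterE => s; rewrite /diffquot01/=; ring.
Qed.

Lemma is_deriv01M h k t l m : is_deriv01 h t l -> is_deriv01 k t m ->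
  is_deriv01 (fun s => h s * k s) t (l * k t + h t * m).
Proof.
move=> hl km.
have hh : h @ within `[0, 1] t^' --> h t.
  have [d d0 hd] := is_deriv01_locally_lipschitz _ _ _ hl.
  apply/cvgrPdist_le => e e0.
  pose d' := Num.min d (e / (`|l| + 1)).
  have l1 : 0 < `|l| + 1 by rewrite ltr_wpDl.
  have d'0 : 0 < d' by rewrite lt_min d0 divr_gt0.
  exists d' => //= s sd' _ s01; rewrite distrC.
  have /andP[sd se] : (`|t - s| < d) && (`|t - s| < e / (`|l| + 1)) by rewrite -lt_min.
  by rewrite (le_trans (hd _ _ _))// ?(distrC s)// mulrC -ler_pdivlMr// ltW.
have : (fun s => diffquot01 h t s * k t + h s * diffquot01 k t s) @ within `[0, 1] t^'
    --> l * k t + h t * m by apply: cvgD; [apply: cvgMl|apply: cvgM].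
apply: cvg_trans; apply: near_eq_cvg; apply: filterE => s; rewrite /diffquot01.
by ring.
Qed.

Lemma within01_continuousP h : {within `[0, 1], continuous h} <->
  (forall t, t \in `[0, 1] -> forall e, 0 < e -> exists2 d, 0 < d &
    forall s, s \in `[0, 1] -> `|s - t| < d -> `|h s - h t| <= e).
Proof.
split=> [/(@subspace_continuousP R `[0, 1]%classic R h) ch t /ch /cvgrPdist_le ht e /ht[d /= d0 hd]|ch].
  by exists d => // s s01 sd; rewrite distrC hd//= distrC.
apply/(@subspace_continuousP R `[0, 1]%classic R h) => t /ch ht; apply/cvgrPdist_le => e /ht[d d0 hd].
by exists d => //= s sd s01; rewrite distrC hd//= distrC.
Qed.

Lemma derivable01_within_continuous h : {in `[0, 1], forall t, derivable01 h t} ->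
  {within `[0, 1], continuous h}.
Proof.
move=> dh; apply/within01_continuousP => t t01 e e0.
have [d d0 hd] := is_deriv01_locally_lipschitz _ _ _ (derivable01P _ _ (dh _ t01)).
have l1 : 0 < `|deriv01 h t| + 1 by rewrite ltr_wpDl.
exists (Num.min d (e / (`|deriv01 h t| + 1))); first by rewrite lt_min d0 divr_gt0.
move=> s s01; rewrite lt_min => /andP[sd se].
by rewrite (le_trans (hd _ s01 sd))// mulrC -ler_pdivlMr// ltW.
Qed.

Lemma within01_continuous_interior h t : {within `[0, 1], continuous h} ->
  t \in `]0, 1[ -> {for t, continuous h}.
Proof.
move=> /within01_continuousP ch t01.
have t0 : t \in `[0, 1] by exact: subset_itv_oo_cc.
have := t01; rewrite in_itv/= => /andP[t0' t1'].
apply/cvgrPdist_le => e /(ch _ t0)[d d0 hd].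
exists (Num.min d (Num.min t (1 - t))) => /=; first by rewrite !lt_min d0 t0' subr_gt0.
move=> s sd'; rewrite distrC.
have /and3P[sd st st1] : [&& `|t - s| < d, `|t - s| < t & `|t - s| < 1 - t].
  by rewrite -!lt_min.
apply: hd; last by rewrite distrC.
by move: st st1; rewrite !ltr_norml in_itv/= => /andP[? ?] /andP[? ?]; apply/andP; split; lra.
Qed.

End UnitIntervalCalculus.

(** * Kernel integrals *)

Section Primitive.
Context {R : realType}.
Local Notation mu := (@lebesgue_measure R).

Definition clamp (a b t : R) : R := Num.max a (Num.min b t).

Lemma clamp_itv a b t : a <= b -> clamp a b t \in `[a, b].
Proof. by move=> ab; rewrite in_itv/= /clamp le_max lexx ge_max ab ge_min lexx. Qed.

Lemma clamp_id a b t : t \in `[a, b] -> clamp a b t = t.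
Proof. by rewrite in_itv/= /clamp => /andP[a_t tb]; rewrite (min_idPr tb) (max_idPr a_t). Qed.

Lemma clamp_lipschitz a b s t : `|clamp a b s - clamp a b t| <= `|s - t|.
Proof.
rewrite /clamp /Num.max /Num.min ler_norml; have := ler_norm (s - t).
have := ler_norm (t - s); rewrite [`|t - s|]distrC.
by case: (ltP b s) => ?; case: (ltP b t) => ?; do ?[case: ltP => ?]; lra.
Qed.

Lemma clamp_continuous a b : continuous (clamp a b).
Proof.
move=> t; apply/cvgrPdist_le => e e0; exists e => //= s st.
by rewrite (le_trans (clamp_lipschitz _ _ _ _))// ltW.
Qed.

Lemma within01_clamp_continuous (h : R -> R) :
  {within `[0, 1], continuous h} -> continuous (fun t => h (clamp 0 1 t)).
Proof.
move=> /within01_continuousP ch t; apply/cvgrPdist_le => e e0.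
have [d d0 hd] := ch _ (clamp_itv 0 1 t ler01) _ e0.
exists d => //= s st; rewrite distrC hd ?clamp_itv//.
by rewrite (le_lt_trans (clamp_lipschitz _ _ _ _))// distrC.
Qed.

(** Clamping the argument extends [h] continuously to the line. Integrating from -1 makes every
    point of [0, 1], end points included, an interior point for the fundamental theorem. *)
Lemma within01_primitive (h : R -> R) : {within `[0, 1], continuous h} ->
  exists2 P, P 0 = 0 & {in `[0, 1], forall t, is_deriv01 P t (h t)}.
Proof.
move=> /within01_clamp_continuous; set hc := (fun t => _) => ch.
have ihc : mu.-integrable `[-1, 2] (EFin \o hc).
  apply: continuous_compact_integrable; first exact: segment_compact.
  by apply: continuous_subspaceT.
pose P (t : R) := (\int[mu]_(s in `[-1, t]) hc s)%R.
have dP (t : R) : t \in `[0, 1] -> is_derive t 1 P (h t).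
  rewrite in_itv/= => /andP[t0 t1].
  have t2 : t < 2 by lra.
  have t1N : -1 < t by lra.
  have [dPt Pt] := @continuous_FTC1_closed R hc (-1) t 2 t2 ihc t1N (ch t).
  by apply: DeriveDef => //; rewrite -derive1E Pt /hc clamp_id// in_itv/= t0.
exists (fun t => P t - P 0); first by rewrite subrr.
move=> t /dP/is_derive_is_deriv01/is_deriv01P hP; apply/is_deriv01P => e /hP[d d0 hd].
by exists d => // s s01 sd; rewrite opprB addrA subrK hd.
Qed.

End Primitive.

(** The truncated power x_+^a. For [a > 0] it lets one formula describe the fractional integral of
    an indicator before, inside and after its interval. *)
Definition pos_pow {R : realType} (a x : R) : R := Num.max 0 x `^ a.

Section PsiKernel.
Context {R : realType}.
Local Notation mu := (@lebesgue_measure R).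
Variable psi : R -> R.
Hypothesis psiC2 : C2_01 psi.
Hypothesis psi_incr : {in `[0, 1] &, {homo psi : s t / s < t}}.
Hypothesis dpsi_neq0 : {in `[0, 1], forall t, deriv01 psi t != 0}.
Local Notation p := (deriv01 psi).

Lemma psi_is_deriv01 t : t \in `[0, 1] -> is_deriv01 psi t (p t).
Proof. by case: psiC2 => d _ _ t01; apply: derivable01P; exact: d. Qed.

Lemma psi_continuous : {within `[0, 1], continuous psi}.
Proof. by case: psiC2 => d _ _; exact: derivable01_within_continuous. Qed.

Lemma dpsi_continuous : {within `[0, 1], continuous p}.
Proof. by case: psiC2 => _ d _; exact: derivable01_within_continuous. Qed.

Lemma psi_homo : {in `[0, 1] &, {homo psi : s t / s <= t}}.
Proof.
move=> s t s01 t01; rewrite le_eqVlt => /predU1P[->//|st].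
by rewrite ltW// psi_incr.
Qed.

Lemma dpsi_gt0 t : t \in `[0, 1] -> 0 < p t.
Proof.
move=> t01; rewrite lt_neqAle eq_sym dpsi_neq0//=.
have PF := within01_dnbhs_proper _ t01.
have : \forall s \near within `[0, 1] t^', 0 <= diffquot01 psi t s.
  exists 1 => //= s _ st s01; rewrite /diffquot01.
  have [ts|ts|ts] := ltgtP t s.
  - by rewrite divr_ge0// subr_ge0 ?ltW// psi_incr.
  - by rewrite -mulrNN -invrN !opprB divr_ge0// subr_ge0 ?ltW// psi_incr.
  - by move: st; rewrite ts eqxx.
by apply: limr_ge; have := psi_is_deriv01 _ t01 => h; apply/cvg_ex; exists (p t).
Qed.

Section BetaIdentity.
Variables r t : R.
Hypotheses (r0 : 0 <= r) (rt : r < t) (t1 : t <= 1).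
Let L := psi t - psi r.

Let sub01 s : s \in `[r, t] -> s \in `[0, 1].
Proof. by rewrite !in_itv/= => /andP[rs st]; rewrite (le_trans r0)// (le_trans st). Qed.

Let r01 : r \in `[0, 1]. Proof. by rewrite sub01// in_itv/= lexx ltW. Qed.
Let t01 : t \in `[0, 1]. Proof. by rewrite sub01// in_itv/= lexx ltW. Qed.

Let inside s : s \in `]r, t[ -> [/\ s \in `]0, 1[, psi r < psi s & psi s < psi t].
Proof.
move=> srt; have s01 : s \in `[0, 1] by apply: sub01; exact: subset_itv_oo_cc.
move: srt; rewrite !in_itv/= => /andP[rs st].
by rewrite (le_lt_trans r0 rs) (lt_le_trans st t1) !psi_incr.
Qed.

(* Substitution of [v = (psi s - psi r) / (psi t - psi s)]. *)
Lemma psi_beta_integral a b :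
  (\int[mu]_(s in `]r, t[)
     (p s * (psi t - psi s) `^ (a - 1) * (psi s - psi r) `^ (b - 1))%:E =
   (L `^ (a + b - 1))%:E * eBeta a b)%E.
Proof.
have L0 : 0 < L by rewrite subr_gt0 psi_incr.
pose F s := (psi s - psi r) / (psi t - psi s).
pose f s := p s * L / ((psi t - psi s) * (psi t - psi s)).
pose G (v : R) := v `^ (b - 1) * (1 + v) `^ (- (a + b)).
pose D : set R := `]r, t[%classic.
have FD : F @` D = `]0, +oo[%classic.
  rewrite eqEsubset; split => [_ [s /inside[_ rs st] <-]|y].
    by rewrite /= in_itv/= andbT divr_gt0 ?subr_gt0.
  rewrite /= in_itv/= andbT => y0; have y1 : 0 < 1 + y by rewrite addr_gt0.
  (* [w] is the value of [psi s] that solves [F s = y]; it lies strictly between [psi r] and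
     [psi t]. *)
  pose w := (psi r + y * psi t) / (1 + y).
  have [rw wt] : psi r < w /\ w < psi t.
    rewrite /w ltr_pdivlMr// ltr_pdivrMr//.
    by move: L0 (mulr_gt0 y0 L0); rewrite /L => h1 h2; split; lra.
  have cpsi : {within `[r, t], continuous psi}.
    by apply: continuous_subspaceW psi_continuous => s /sub01.
  have rt_psi : psi r <= psi t by rewrite ltW// psi_incr.
  have [|s srt sw] := @IVT R psi r t w (ltW rt) cpsi.
    by rewrite (min_idPl rt_psi) (max_idPr rt_psi) !ltW.
  exists s.
    move: srt; rewrite /D /= !in_itv/= !le_eqVlt => /andP[/predU1P[rs|->]].
      by move: rw; rewrite -sw rs ltxx.
    by move=> /predU1P[st|//]; move: wt; rewrite -sw st ltxx.
  rewrite /F sw /w; field; rewrite (gt_eqF y1)/=.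
  rewrite (_ : _ - _ = L); last by rewrite /L; ring.
  by rewrite gt_eqF.
have dF s : D s -> is_derive s 1 F (f s).
  move=> /inside[s01 rs st].
  have st0 : psi t - psi s != 0 by rewrite subr_eq0 gt_eqF.
  have ds : is_derive s 1 psi (p s).
    apply: is_deriv01_is_derive => //; apply: psi_is_deriv01.
    exact: subset_itv_oo_cc.
  have d1 : is_derive s 1 (psi - cst (psi r)) (p s - 0) by apply: is_deriveB.
  have d2 : is_derive s 1 (cst (psi t) - psi) (0 - p s) by apply: is_deriveB.
  have d3 : is_derive s 1 (fun u => ((cst (psi t) - psi) u)^-1)
      (- (psi t - psi s) ^- 2 *: (0 - p s)) by apply: is_deriveV.
  have d4 : is_derive s 1 F ((psi s - psi r) *: (- (psi t - psi s) ^- 2 *: (0 - p s)) +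
     (psi t - psi s)^-1 *: (p s - 0)) by exact: (is_deriveM d1 d3).
  apply: (is_derive_eq d4).
  by rewrite /f /L /GRing.scale/=; field.
have intG : (\int[mu]_(v in `]0%R, +oo[) (L `^ (a + b - 1) * G v)%:E =
    (L `^ (a + b - 1))%:E * eBeta a b)%E.
  under eq_integral do rewrite EFinM.
  rewrite ge0_integralZl//.
  - apply/measurable_EFinP; apply: measurable_funTS; apply: measurable_funM.
      exact: measurable_powR.
    by apply: (measurableT_comp (measurable_powR _)); exact: measurable_funD.
  - by move=> v _; rewrite lee_fin mulr_ge0 ?powR_ge0.
  - by rewrite lee_fin powR_ge0.
rewrite -intG -FD.
(* The margins used below are [d n / 2]: with [d 0 = h] itself the first interval would shrink to
   the midpoint of [r, t]. *)
pose h := (t - r) / 2; pose d (n : nat) := h / n.+1%:R.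
have h0 : 0 < h by rewrite divr_gt0// subr_gt0.
have d0 n : 0 < d n by rewrite divr_gt0.
have d_dec m n : (m <= n)%N -> d n <= d m.
  by move=> mn; rewrite ler_pM2l// lef_pV2 ?posrE// ler_nat ltnS.
have dh n : d n <= h by have := d_dec 0%N n isT; rewrite {2}/d divr1.
rewrite (@ge0_integration_by_substitution_exhaustion R F f
   (fun v => L `^ (a + b - 1) * G v) D (fun n => r + d n / 2) (fun n => t - d n / 2)).
- apply: eq_integral => s /set_mem /inside[s01 rs st]; congr EFin.
  have A0 : 0 < psi t - psi s by rewrite subr_gt0.
  have B0 : 0 < psi s - psi r by rewrite subr_gt0.
  (* Since [1 + F s = L / (psi t - psi s)], the integrand becomes a product of powers of [L],
     [psi t - psi s] and [psi s - psi r]. *)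
  have -> : G (F s) = ((psi s - psi r) / (psi t - psi s)) `^ (b - 1) *
      (L / (psi t - psi s)) `^ (- (a + b)).
    by rewrite /G /F; congr (_ * powR _ _); rewrite /L; field; rewrite gt_eqF.
  have powR_div x y z : 0 < x -> 0 < y -> (x / y) `^ z = x `^ z * y `^ (- z).
    move=> x0 y0; rewrite powRM ?invr_ge0 ?ltW//; congr (_ * _).
    by rewrite -powR_inv1 ?ltW// -powRrM mulN1r.
  rewrite !powR_div// /f opprK; set A := psi t - psi s.
  have E1 : L `^ (- (a + b)) = (L `^ (a + b - 1) * L)^-1 by rewrite powRN powRB1.
  have E2 : A `^ (a + b) = A `^ (a - 1) * A `^ (b - 1) * A * A.
    rewrite -powRD_gt0// (_ : a - 1 + (b - 1) = a + b - 1 - 1); last by ring.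
    by rewrite powRB1// powRB1.
  rewrite E1 E2 powRN.
  have := powR_gt0 (a + b - 1) L0; have := powR_gt0 (b - 1) A0.
  move: (L `^ _) (A `^ (b - 1)) => l m m0 l0; field.
  by rewrite !gt_eqF.
- by move=> m n mn; rewrite lerD2l ler_pM2r// d_dec.
- by move=> m n mn; rewrite lerD2l lerN2 ler_pM2r// d_dec.
- by move=> n; have := dh n; have := d0 n; rewrite /h; lra.
- rewrite eqEsubset; split => [s|s [n _]]; rewrite /D /= !in_itv/= => /andP[rs st]; last first.
    by have := d0 n; move=> ?; apply/andP; split; lra.
  have m0 : 0 < Num.min (s - r) (t - s) by rewrite lt_min !subr_gt0 rs.
  pose n := Num.truncn (h / Num.min (s - r) (t - s)).
  have dm : d n <= Num.min (s - r) (t - s).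
    by rewrite /d ler_pdivrMr// mulrC -ler_pdivrMr// ltW// truncnS_gt.
  have := d0 n; move: dm; rewrite le_min => /andP[? ?] ?.
  by exists n => //=; rewrite in_itv/=; apply/andP; split; lra.
- move=> x y Dx Dy xy; have [x01 rx xt] := inside x Dx; have [y01 ry yt] := inside y Dy.
  have xy_psi : psi x < psi y by apply: psi_incr => //; exact: subset_itv_oo_cc.
  rewrite /F ltr_pdivrMr ?subr_gt0// mulrAC ltr_pdivlMr ?subr_gt0//.
  have := mulr_gt0 L0 (_ : 0 < psi y - psi x); rewrite subr_gt0 /L => /(_ xy_psi) ?; lra.
- move=> s Ds; have [s01 rs st] := inside s Ds.
  apply: continuousM; last first.
    have cA : {for s, continuous (fun u => psi t - psi u)}.
      apply: continuousB; first exact: cst_continuous.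
      exact: within01_continuous_interior psi_continuous _.
    apply: continuousV; first by rewrite mulf_neq0// subr_eq0 gt_eqF.
    exact: continuousM.
  apply: continuousM; last exact: cst_continuous.
  exact: within01_continuous_interior dpsi_continuous _.
- move=> s Ds; have [_ rs st] := inside s Ds.
  have Fs0 : 0 < F s by rewrite divr_gt0 ?subr_gt0.
  apply: continuousM; first exact: cst_continuous.
  apply: continuousM; first exact: continuous_powR.
  apply: (@continuous_comp _ _ _ (fun t : R => 1 + t) (fun t => t `^ (- (a + b)))).
    by apply: continuousD; [exact: cst_continuous|exact: cvg_id].
  by apply: continuous_powR; rewrite addr_gt0.
- move=> s Ds; have [s01 rs st] := inside s Ds.
  have ps : 0 < p s by apply: dpsi_gt0; exact: subset_itv_oo_cc.
  have A0 : 0 < psi t - psi s by rewrite subr_gt0.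
  by apply/ltW/divr_gt0; exact: mulr_gt0.
- by move=> s Ds; rewrite !mulr_ge0 ?powR_ge0.
Qed.

End BetaIdentity.
End PsiKernel.

(** * Fractional integrals *)

Section PosPow.
Context {R : realType}.
Implicit Types a x y : R.

Lemma pos_pow_ge0 a x : 0 <= pos_pow a x.
Proof. exact: powR_ge0. Qed.

Lemma pos_powE a x : 0 <= x -> pos_pow a x = x `^ a.
Proof. by move=> x0; rewrite /pos_pow (max_idPr x0). Qed.

Lemma pos_pow_le0 a x : 0 < a -> x <= 0 -> pos_pow a x = 0.
Proof. by move=> a0 x0; rewrite /pos_pow (max_idPl x0) powR0// gt_eqF. Qed.

Lemma pos_pow_homo a : 0 < a -> {homo @pos_pow R a : x y / x <= y}.
Proof.
move=> a0 x y xy; have m0 (z : R) : 0 <= Num.max 0 z by rewrite le_max lexx.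
apply: ge0_ler_powR; rewrite ?nnegrE ?(ltW a0)//.
by rewrite ge_max m0 le_max xy orbT.
Qed.

Lemma pos_pow_continuous a : 0 < a -> continuous (@pos_pow R a).
Proof.
move=> a0 x; have [x0|x0|->] := ltgtP x 0.
- rewrite /continuous_at (pos_pow_le0 _ _ a0 (ltW x0)); apply: cvg_near_cst; near=> y.
  by apply: (pos_pow_le0 _ _ a0); rewrite ltW//; near: y; exact: lt_nbhsl.
- rewrite /continuous_at (pos_powE _ _ (ltW x0)); apply: cvg_trans (continuous_powR _ _ x0).
  apply: near_eq_cvg; near=> y; rewrite pos_powE// ltW//.
  by near: y; exact: lt_nbhsr.
apply/cvgrPdist_le => e e0; rewrite (pos_pow_le0 _ _ a0 (lexx _)).
exists (e `^ a^-1) => /=; first by rewrite powR_gt0.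
move=> y yd; have {}yd : `|0 - y| < e `^ a^-1 := yd.
rewrite sub0r normrN in yd.
rewrite distrC subr0 ger0_norm ?pos_pow_ge0//.
have -> : e = (e `^ a^-1) `^ a by rewrite -powRrM mulVf ?gt_eqF// powRr1 ?ltW.
have m0 (z : R) : 0 <= Num.max 0 z by rewrite le_max lexx.
apply: ge0_ler_powR; rewrite ?nnegrE ?powR_ge0 ?(ltW a0)//.
by rewrite ge_max powR_ge0/= (le_trans (ler_norm y))// ltW.
Unshelve. all: by end_near. Qed.

(* Convexity: the increments of [pos_pow a] are nondecreasing. *)
Lemma pos_pow_increment a x y h : 1 <= a -> x <= y -> 0 <= h ->
  pos_pow a (x + h) - pos_pow a x <= pos_pow a (y + h) - pos_pow a y.
Proof.
move=> a1 xy h0; have a0 : 0 < a by lra.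
have main u v : 0 <= u -> u <= v -> pos_pow a (u + h) - pos_pow a u <=
    pos_pow a (v + h) - pos_pow a v.
  move=> u0 uv; have [vh|vh] := eqVneq (v + h) u.
    have -> : v = u by lra.
    exact: lexx.
  have w0 : 0 < v + h - u by rewrite lt_neqAle eq_sym subr_eq0 vh /=; lra.
  (* With this ratio [q], the points [u + h] and [v] are convex combinations of [u] and [v + h] with
     complementary weights, so adding the two convexity inequalities gives the claim. *)
  have q0 : 0 <= h / (v + h - u) by rewrite divr_ge0// ltW.
  have q1 : h / (v + h - u) <= 1 by rewrite ler_pdivrMr//; lra.
  have q0' : 0 <= 1 - h / (v + h - u) by rewrite subr_ge0.
  have q1' : 1 - h / (v + h - u) <= 1 by rewrite gerBl.
  have uI : u \in (`[0, +oo[%classic : set R) by rewrite inE/= in_itv/= u0.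
  have vI : v + h \in (`[0, +oo[%classic : set R) by rewrite inE/= in_itv/= andbT; lra.
  have C (s : R) (s0 : 0 <= s) (s1 : s <= 1) :
      (s * u + (1 - s) * (v + h)) `^ a <= s * u `^ a + (1 - s) * (v + h) `^ a.
    by have := convex_powR a1 (Itv01 s0 s1) uI vI; rewrite !convRE.
  have := C _ q0 q1; have := C _ q0' q1'; set q := h / _.
  have -> : (1 - q) * u + (1 - (1 - q)) * (v + h) = u + h.
    by rewrite /q; field; rewrite gt_eqF.
  have -> : q * u + (1 - q) * (v + h) = v by rewrite /q; field; rewrite gt_eqF.
  rewrite !pos_powE ?addr_ge0//; last 2 first.
  - exact: le_trans uv.
  - exact: le_trans uv.
  by lra.
have [x0|x0] := leP 0 x; first exact: main.
rewrite (pos_pow_le0 _ _ a0 (ltW x0)) subr0.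
have [y0|y0] := leP 0 y.
  apply: le_trans (main 0 y _ _) => //; rewrite (pos_pow_le0 _ _ a0 (lexx 0)) subr0 add0r.
  by apply: pos_pow_homo => //; lra.
by rewrite (pos_pow_le0 _ _ a0 (ltW y0)) subr0; apply: pos_pow_homo => //; lra.
Qed.

End PosPow.

Section UnitIntervalContinuity.
Context {R : realType}.
Implicit Types h k : R -> R.

Local Notation cont01 h := {within `[0, 1], continuous h}.

Lemma cont01P h : cont01 h <->
  forall t : R, t \in `[0, 1] -> h @ within `[0, 1] (nbhs t) --> h t.
Proof. exact: (@subspace_continuousP R `[0, 1]%classic R h). Qed.

Lemma cont01_comp h (g : R -> R) : cont01 h -> continuous g -> cont01 (fun s => g (h s)).
Proof.
move=> /cont01P ch cg; apply/cont01P => t t01.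
by apply: continuous_cvg; [exact: cg|exact: ch].
Qed.

Lemma cont01_lincomb (c : R) h k : cont01 h -> cont01 k ->
  cont01 (fun s => c * h s + k s).
Proof.
move=> /cont01P ch /cont01P ck; apply/cont01P => t t01.
by apply: cvgD; [apply: cvgMr; exact: ch|exact: ck].
Qed.

Lemma cont01M h k : cont01 h -> cont01 k -> cont01 (fun s => h s * k s).
Proof.
move=> /cont01P ch /cont01P ck; apply/cont01P => t t01.
by apply: cvgM; [exact: ch|exact: ck].
Qed.

Lemma cont01_bounded h : cont01 h -> exists M, {in `[0, 1], forall t, `|h t| <= M}.
Proof.
move=> ch; have [|c _ hc] := @EVT_max R (fun t => `|h t|) 0 1 ler01.
  by apply: (cont01_comp _ (fun x => `|x|)) => //; exact: norm_continuous.
by exists `|h c| => t; exact: hc.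
Qed.

Lemma cont01_measurable h (t : R) : t \in `[0, 1] -> cont01 h ->
  measurable_fun (`[0, t]%classic : set R) h.
Proof.
move=> t01 ch; apply: (@measurable_funS _ _ _ _ (`[0, 1]%classic : set R)) => //.
  by move: t01; rewrite in_itv/= => /andP[_ t1]; apply: subset_itvl; rewrite bnd_simp.
by apply: subspace_continuous_measurable_fun.
Qed.

End UnitIntervalContinuity.

Section FractionalIntegral.
Context {R : realType}.
Local Notation mu := (@lebesgue_measure R).
Local Notation cont01 h := {within `[0, 1], continuous h}.
Variable psi : R -> R.
Hypothesis psiC2 : C2_01 psi.
Hypothesis psi_incr : {in `[0, 1] &, {homo psi : s t / s < t}}.
Hypothesis dpsi_neq0 : {in `[0, 1], forall t, deriv01 psi t != 0}.
Variable theta : R.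
Hypothesis theta01 : 0 < theta < 1.
Local Notation p := (deriv01 psi).
Local Notation K t s := (p s * (psi t - psi s) `^ (theta - 1)).

Let theta0 : 0 < theta. Proof. by case/andP: theta01. Qed.

Lemma eBetaE (a b : R) : 0 < a -> 0 < b -> eBeta a b = (Gamma a * Gamma b / Gamma (a + b))%:E.
Proof.
move=> a0 b0; have ab0 : 0 < a + b by rewrite addr_gt0.
have := eGammaM a b; rewrite !eGammaE// -EFinM.
have G0 := Gamma_gt0 _ ab0; case: (eBeta a b) => [r| |].
- by rewrite -EFinM => -[->]; rewrite mulrC mulKf// gt_eqF.
- by rewrite gt0_muley ?lte_fin.
- by rewrite gt0_muleNy ?lte_fin.
Qed.

Let measurable_psi (t : R) : t \in `[0, 1] -> measurable_fun (`[0, t]%classic : set R) psi.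
Proof. by move=> t01; apply: cont01_measurable => //; exact: psi_continuous. Qed.

Lemma measurable_kernel t : t \in `[0, 1] ->
  measurable_fun (`[0, t]%classic : set R) (fun s => K t s).
Proof.
move=> t01; apply: measurable_funM.
  by apply: cont01_measurable => //; exact: dpsi_continuous.
apply: (measurableT_comp (measurable_powR _)).
by apply: measurable_funB => //; exact: measurable_psi.
Qed.

Let sub01 (s t : R) : t \in `[0, 1] -> s \in `[0, t] -> s \in `[0, 1].
Proof. by rewrite !in_itv/= => /andP[_ t1] /andP[-> st]; exact: le_trans st t1. Qed.

Let psi_ge s t : t \in `[0, 1] -> s \in `[0, t] -> psi s <= psi t.
Proof.
move=> t01 st; apply: (psi_homo _ psi_incr) => //; first exact: sub01 st.
by move: st; rewrite in_itv/= => /andP[].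
Qed.

Lemma kernel_ge0 s t : t \in `[0, 1] -> s \in `[0, t] -> 0 <= K t s.
Proof.
move=> t01 st; rewrite mulr_ge0 ?powR_ge0// ltW//.
by apply: dpsi_gt0 => //; exact: sub01 st.
Qed.

Lemma integral_kernel t : t \in `[0, 1] ->
  (\int[mu]_(s in `[0%R, t]) (K t s)%:E = ((psi t - psi 0) `^ theta / theta)%:E)%E.
Proof.
move=> t01; have [t0|t0] := eqVneq t 0.
  by rewrite t0 subrr powR0 ?gt_eqF// mul0r set_itv1 integral_set1.
have {}t0 : 0 < t by rewrite lt_neqAle eq_sym t0; move: t01; rewrite in_itv/= => /andP[].
have t1 : t <= 1 by move: t01; rewrite in_itv/= => /andP[].
rewrite (@integral_itv_bndoo R 0 t (fun s => (K t s)%:E) true false); last first.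
  apply/measurable_EFinP; apply: measurable_funS (measurable_kernel _ t01) => //.
  by move=> s /=; exact: subset_itv_oo_cc.
have := psi_beta_integral psi psiC2 psi_incr dpsi_neq0 0 t (lexx 0) t0 t1 theta 1.
rewrite eBetar1// addrK -EFinM => <-.
by apply: eq_integral => s _; rewrite subrr powRr0 mulr1.
Qed.

Lemma integral_kernel_pos_pow b r t : 0 < b -> r \in `[0, 1] -> t \in `[0, 1] ->
  (\int[mu]_(s in `[0%R, t]) (K t s * pos_pow b (psi s - psi r))%:E =
   (Gamma theta * Gamma (b + 1) / Gamma (theta + b + 1) *
     pos_pow (theta + b) (psi t - psi r))%:E)%E.
Proof.
move=> b0 r01 t01; have tb0 : 0 < theta + b by rewrite addr_gt0.
have [tr|rt] := leP t r.
  rewrite pos_pow_le0//; last by rewrite subr_le0; apply: (psi_homo _ psi_incr).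
  rewrite mulr0 integral0_eq// => s st; rewrite pos_pow_le0 ?mulr0// subr_le0.
  rewrite (le_trans (psi_ge _ _ t01 st))//; exact: (psi_homo _ psi_incr).
have r0 : 0 <= r by move: r01; rewrite in_itv/= => /andP[].
have t1 : t <= 1 by move: t01; rewrite in_itv/= => /andP[].
have rtpsi : psi r < psi t by apply: psi_incr.
transitivity (\int[mu]_(s in `]r, t[) (K t s * (psi s - psi r) `^ (b + 1 - 1))%:E)%E.
  rewrite integral_mkcond [RHS]integral_mkcond; apply: eq_integral => s _; rewrite !patchE.
  rewrite addrK; case: ifPn => [/set_mem/= st|st]; case: ifPn => [/set_mem/= srt|srt]//.
  - rewrite pos_powE// subr_ge0; apply: (psi_homo _ psi_incr) => //.
      exact: sub01 st.
    by move: srt; rewrite in_itv/= => /andP[/ltW].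
  - congr EFin; have [sr|rs] := leP s r.
      rewrite pos_pow_le0 ?mulr0// subr_le0; apply: (psi_homo _ psi_incr) => //.
      exact: sub01 st.
    (* The end point [s = t] belongs to the first domain only; there the kernel has the default
       value 0 of [powR], as its exponent is not 0. *)
    have -> : s = t.
      move: srt st; rewrite notin_setE/= !in_itv/= rs/= => /negP; rewrite -leNgt => ts /andP[_ ?].
      by apply/eqP; rewrite eq_le ts andbT.
    rewrite subrr powR0 ?mulr0 ?mul0r// subr_eq0.
    by case/andP: theta01 => _ /lt_eqF ->.
  - exfalso; move/negP: st; apply; rewrite inE /= in_itv/=.
    move: srt; rewrite in_itv/= => /andP[rs st].
    by rewrite (le_trans r0 (ltW rs)) ltW.
rewrite psi_beta_integral// eBetaE//; last by rewrite addr_gt0.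
rewrite -EFinM pos_powE ?subr_ge0 ?ltW// addrA addrK; congr EFin.
by rewrite mulrC.
Qed.

Lemma integrable_kernelM (z : R -> R) (t : R) : t \in `[0, 1] -> cont01 z ->
  mu.-integrable `[0, t] (fun s => (K t s * z s)%:E).
Proof.
move=> t01 cz; have [M zM] := cont01_bounded _ cz.
have iK : mu.-integrable `[0, t] (fun s => (K t s)%:E).
  apply/integrableP; split; first by apply/measurable_EFinP; exact: measurable_kernel.
  rewrite (_ : integral _ _ _ = (\int[mu]_(s in `[0%R, t]) (K t s)%:E)%E).
    by rewrite integral_kernel// ltry.
  apply: eq_integral => s /set_mem/= st.
  by rewrite /= ger0_norm// kernel_ge0.
have iMK : mu.-integrable `[0, t] (fun s => (M%:E * (K t s)%:E)%E) by exact: integrableZl.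
apply: le_integrable iMK => //.
- apply/measurable_EFinP; apply: measurable_funM; first exact: measurable_kernel.
  exact: cont01_measurable.
- move=> s /= st; suff : `|K t s * z s| <= `|M * K t s| by rewrite -lee_fin.
  rewrite [leLHS]normrM [leRHS]normrM mulrC.
  by rewrite ler_wpM2r// (le_trans (zM _ (sub01 _ _ t01 st)))// ler_norm.
Qed.

Lemma psi_RLint_pos_pow (b r t : R) : 0 < b -> r \in `[0, 1] -> t \in `[0, 1] ->
  psi_RLint theta psi (fun s => pos_pow b (psi s - psi r)) t =
  Gamma (b + 1) / Gamma (theta + b + 1) * pos_pow (theta + b) (psi t - psi r).
Proof.
move=> b0 r01 t01; rewrite /psi_RLint /Rintegral integral_kernel_pos_pow//=.
have G0 := Gamma_gt0 _ theta0; field.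
by rewrite !gt_eqF// Gamma_gt0 ?addr_gt0.
Qed.

Lemma psi_RLint_lincomb (c : R) (z1 z2 : R -> R) (t : R) : t \in `[0, 1] -> cont01 z1 -> cont01 z2 ->
  psi_RLint theta psi (fun s => c * z1 s + z2 s) t =
  c * psi_RLint theta psi z1 t + psi_RLint theta psi z2 t.
Proof.
move=> t01 c1 c2; rewrite /psi_RLint mulrCA -mulrDr; congr (_ * _).
have i1 := integrable_kernelM _ _ t01 c1; have i2 := integrable_kernelM _ _ t01 c2.
have i1' : mu.-integrable `[0, t] (fun s => (c%:E * (K t s * z1 s)%:E)%E).
  exact: integrableZl.
rewrite -RintegralZl// -RintegralD//.
by apply: eq_Rintegral => s _; ring.
Qed.

Lemma psi_RLint_le (z1 z2 : R -> R) (t : R) : t \in `[0, 1] -> cont01 z1 -> cont01 z2 ->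
  {in `[0, 1], forall s, z1 s <= z2 s} ->
  psi_RLint theta psi z1 t <= psi_RLint theta psi z2 t.
Proof.
move=> t01 c1 c2 z12; rewrite /psi_RLint ler_pM2l ?invr_gt0 ?Gamma_gt0//.
apply: le_Rintegral => //; try exact: integrable_kernelM.
move=> s /= st; rewrite ler_wpM2l ?kernel_ge0// z12//.
exact: sub01 st.
Qed.

Lemma psi_RLint_cst (e t : R) : t \in `[0, 1] ->
  psi_RLint theta psi (cst e) t = e * ((psi t - psi 0) `^ theta / Gamma (theta + 1)).
Proof.
move=> t01; rewrite /psi_RLint.
rewrite (_ : (\int[mu]_(s in `[0, t]) _)%R = (psi t - psi 0) `^ theta / theta * e).
  by rewrite GammaS//; field; rewrite !gt_eqF// Gamma_gt0.
have c1 : cont01 (cst 1 : R -> R) by apply: continuous_subspaceT; exact: cst_continuous.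
have i1 := integrable_kernelM (cst 1 : R -> R) _ t01 c1.
have -> : (psi t - psi 0) `^ theta / theta = (\int[mu]_(s in `[0, t]) (K t s * cst 1 s))%R.
  rewrite /Rintegral; under eq_integral do rewrite /cst mulr1.
  by rewrite integral_kernel.
by rewrite mulrC -RintegralZl//; apply: eq_Rintegral => s _; rewrite /cst /=; ring.
Qed.

(** The kernel is nonnegative with finite mass, so the fractional integral is monotone and explicit
    on constants. This carries uniform convergence of the discrete sums through the integral. *)
Lemma psi_RLint_close (z1 z2 : R -> R) (e t : R) : t \in `[0, 1] -> cont01 z1 -> cont01 z2 ->
  {in `[0, 1], forall s, `|z1 s - z2 s| <= e} ->
  `|psi_RLint theta psi z1 t - psi_RLint theta psi z2 t| <=
  e * ((psi t - psi 0) `^ theta / Gamma (theta + 1)).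
Proof.
move=> t01 c1 c2 z12.
have ce : cont01 (cst e : R -> R) by apply: continuous_subspaceT; exact: cst_continuous.
have le_shift (u v : R -> R) : cont01 u -> cont01 v -> {in `[0, 1], forall s, u s - v s <= e} ->
    psi_RLint theta psi u t - psi_RLint theta psi v t <=
    e * ((psi t - psi 0) `^ theta / Gamma (theta + 1)).
  move=> cu cv uv; rewrite -psi_RLint_cst// lerBlDr -[psi_RLint _ _ (cst e) _]mul1r.
  rewrite -psi_RLint_lincomb//; apply: psi_RLint_le => //; first exact: cont01_lincomb.
  by move=> s s01; rewrite mul1r -lerBlDr uv.
rewrite ler_norml lerNl opprB !le_shift//.
- by move=> s /z12; rewrite ler_norml => /andP[].
- by move=> s /z12; rewrite distrC ler_norml => /andP[].
Qed.

End FractionalIntegral.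

(** * Piecewise constant right-hand sides *)

Section Scheme.
Context {R : realType}.
Local Notation cont01 h := {within `[0, 1], continuous h}.
Variable psi : R -> R.
Hypothesis psiC2 : C2_01 psi.
Hypothesis psi_incr : {in `[0, 1] &, {homo psi : s t / s < t}}.
Hypothesis dpsi_neq0 : {in `[0, 1], forall t, deriv01 psi t != 0}.
Variable a : R.
Hypothesis a12 : 1 < a < 2.

Let a0 : 0 < a. Proof. by case/andP: a12 => a1 _; rewrite (lt_trans ltr01). Qed.
Let Ga0 : 0 < Gamma (a + 1). Proof. by rewrite Gamma_gt0// addr_gt0. Qed.

(** There are [n.+1] cells, numbered from 0 to [n], so that every [n] is admissible. *)
Definition grid (n j : nat) : R := j%:R / n.+1%:R.

Lemma grid0 n : grid n 0 = 0. Proof. by rewrite /grid mul0r. Qed.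

Lemma gridS n : grid n n.+1 = 1. Proof. by rewrite /grid divff. Qed.

Lemma grid_homo n i j : (i <= j)%N -> grid n i <= grid n j.
Proof. by move=> ij; rewrite /grid ler_pM2r ?invr_gt0// ler_nat. Qed.

Lemma grid_itv n j : (j <= n.+1)%N -> grid n j \in `[0, 1].
Proof. by move=> jn; rewrite in_itv/= -{1}(grid0 n) -(gridS n) !grid_homo. Qed.

(** The fractional integral of order [a] of the constant 1. It is the sum of all weights and
    controls both the size and the modulus of continuity of [frac_sum]. *)
Definition frac_scale (t : R) : R := pos_pow a (psi t - psi 0) / Gamma (a + 1).

(* Value at [t] of the fractional integral of order [a] of the indicator of the
   [j]-th grid interval. *)
Definition frac_weight n j (t : R) : R :=
  (pos_pow a (psi t - psi (grid n j)) - pos_pow a (psi t - psi (grid n j.+1))) / Gamma (a + 1).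

Definition frac_sum n (w : nat -> R) (t : R) : R :=
  \sum_(j < n.+1) frac_weight n j t * w j.

Let psi_le (s t : R) : s \in `[0, 1] -> t \in `[0, 1] -> s <= t -> psi s <= psi t.
Proof. exact: (psi_homo _ psi_incr). Qed.

Let zero01 : (0 : R) \in `[0, 1]. Proof. by rewrite in_itv/= lexx ler01. Qed.

Lemma frac_weight_ge0 n j t : (j <= n)%N -> 0 <= frac_weight n j t.
Proof.
move=> jn; rewrite divr_ge0 ?(ltW Ga0)// subr_ge0; apply: pos_pow_homo => //.
by rewrite lerD2l lerN2 psi_le ?grid_itv ?grid_homo// leqW.
Qed.

Lemma frac_weight_homo n j s t : (j <= n)%N -> s \in `[0, 1] -> t \in `[0, 1] ->
  s <= t -> frac_weight n j s <= frac_weight n j t.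
Proof.
move=> jn s01 t01 st; rewrite ler_pM2r ?invr_gt0//.
have a1 : 1 <= a by case/andP: a12 => /ltW.
have h0 : 0 <= psi (grid n j.+1) - psi (grid n j).
  by rewrite subr_ge0 psi_le ?grid_itv ?grid_homo// leqW.
have st' : psi s - psi (grid n j.+1) <= psi t - psi (grid n j.+1) by rewrite lerD2r psi_le.
have := pos_pow_increment _ _ _ _ a1 st' h0.
by rewrite !addrA !subrK.
Qed.

Lemma sum_frac_weight n t : t \in `[0, 1] -> \sum_(j < n.+1) frac_weight n j t = frac_scale t.
Proof.
move=> t01; rewrite /frac_weight -mulr_suml; congr (_ / _).
have tele k : \sum_(j < k) (pos_pow a (psi t - psi (grid n j)) -
    pos_pow a (psi t - psi (grid n j.+1))) =
    pos_pow a (psi t - psi (grid n 0)) - pos_pow a (psi t - psi (grid n k)).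
  by elim: k => [|k IH]; [rewrite big_ord0 subrr|rewrite big_ord_recr/= IH addrA subrK].
rewrite tele grid0 gridS [X in _ - X]pos_pow_le0 ?subr0//.
rewrite subr_le0 psi_le//; first by rewrite in_itv/= lexx ler01.
by move: t01; rewrite in_itv/= => /andP[].
Qed.

Lemma frac_scale_homo s t : s \in `[0, 1] -> t \in `[0, 1] -> s <= t ->
  frac_scale s <= frac_scale t.
Proof.
move=> s01 t01 st; rewrite ler_pM2r ?invr_gt0//; apply: pos_pow_homo => //.
by rewrite lerD2r psi_le.
Qed.

Lemma frac_scale_cont : cont01 frac_scale.
Proof.
pose g (x : R) := pos_pow a (x - psi 0) / Gamma (a + 1).
apply: (cont01_comp _ g); first exact: psi_continuous.
move=> x; rewrite /g; apply: cvgMl.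
apply: (@continuous_comp _ _ _ (fun x => x - psi 0) (pos_pow a)).
  by apply: continuousB; [exact: cvg_id|exact: cst_continuous].
exact: pos_pow_continuous.
Qed.

Lemma frac_sum_bound n w M t : t \in `[0, 1] -> (forall j, (j <= n)%N -> `|w j| <= M) ->
  `|frac_sum n w t| <= M * frac_scale t.
Proof.
move=> t01 wM; rewrite -(sum_frac_weight n)// mulr_sumr.
apply: (le_trans (ler_norm_sum _ _ _)); apply: ler_sum => j _.
have jn : (j <= n)%N by rewrite -ltnS.
rewrite normrM ger0_norm ?frac_weight_ge0// mulrC ler_wpM2r ?frac_weight_ge0//.
exact: wM.
Qed.

(** Each weight is nondecreasing in [t], so the absolute increments of the weights add up to the
    increment of their sum. The resulting modulus is that of one fixed function, whatever [n] is. *)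
Lemma frac_sum_modulus n w M s t : s \in `[0, 1] -> t \in `[0, 1] ->
  (forall j, (j <= n)%N -> `|w j| <= M) ->
  `|frac_sum n w t - frac_sum n w s| <= M * `|frac_scale t - frac_scale s|.
Proof.
move=> s01 t01 wM; wlog st : s t s01 t01 / s <= t.
  move=> h; have [/h|/ltW/h] := leP s t; first exact.
  by rewrite distrC [`|frac_scale _ - _|]distrC; exact.
rewrite [`|frac_scale _ - _|]ger0_norm ?subr_ge0 ?frac_scale_homo//.
rewrite -!(sum_frac_weight n)// -!sumrB mulr_sumr.
apply: (le_trans (ler_norm_sum _ _ _)); apply: ler_sum => j _.
have jn : (j <= n)%N by rewrite -ltnS.
rewrite -mulrBl normrM ger0_norm ?subr_ge0 ?frac_weight_homo// mulrC.
by rewrite ler_wpM2r ?subr_ge0 ?frac_weight_homo ?wM.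
Qed.

(** This makes the scheme explicit: the value at grid point [i] involves only the data with index
    below [i]. *)
Lemma frac_weight_causal n j i : (i <= j <= n)%N -> frac_weight n j (grid n i) = 0.
Proof.
case/andP=> ij jn; have jn' : (j <= n.+1)%N by exact: leqW.
have in' : (i <= n.+1)%N by exact: leq_trans jn'.
have ij' : (i <= j.+1)%N by exact: leqW.
by rewrite /frac_weight !pos_pow_le0 ?subrr ?mul0r// subr_le0 psi_le ?grid_itv ?grid_homo.
Qed.

Lemma cont01_pos_pow b (c : R) : 0 < b -> cont01 (fun s => pos_pow b (psi s - c)).
Proof.
move=> b0; apply: (cont01_comp _ (fun x => pos_pow b (x - c))); first exact: psi_continuous.
move=> x; apply: (@continuous_comp _ _ _ (fun x => x - c) (pos_pow b)).
  by apply: continuousB; [exact: cvg_id|exact: cst_continuous].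
exact: pos_pow_continuous.
Qed.

Lemma frac_weight_cont n j : cont01 (frac_weight n j).
Proof.
have h := cont01_lincomb (-1) _ _ (cont01_pos_pow _ (psi (grid n j.+1)) a0)
   (cont01_pos_pow _ (psi (grid n j)) a0).
have h2 := cont01_lincomb (Gamma (a + 1))^-1 _ (cst 0) h.
rewrite (_ : frac_weight n j = (fun s => (Gamma (a + 1))^-1 * (-1 *
   pos_pow a (psi s - psi (grid n j.+1)) + pos_pow a (psi s - psi (grid n j))) + cst 0 s)).
  by apply: h2; apply: continuous_subspaceT; exact: cst_continuous.
by apply/funext => s; rewrite /frac_weight /cst; ring.
Qed.

Lemma frac_sum_cont n w : cont01 (frac_sum n w).
Proof.
rewrite /frac_sum; elim: n.+1 => [|k IH].
  rewrite (_ : (fun _ => _) = cst 0); last by apply/funext => s; rewrite big_ord0.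
  by apply: continuous_subspaceT; exact: cst_continuous.
rewrite (_ : (fun _ => _) = (fun t => w k * frac_weight n k t +
    \sum_(j < k) frac_weight n j t * w j)).
  by apply: cont01_lincomb => //; exact: frac_weight_cont.
by apply/funext => s; rewrite big_ord_recr/= addrC mulrC.
Qed.

Let b01 : 0 < 2 - a < 1.
Proof. by case/andP: a12 => ? ?; apply/andP; split; lra. Qed.

Lemma psi_RLint_frac_weight n j t : (j <= n)%N -> t \in `[0, 1] ->
  psi_RLint (2 - a) psi (frac_weight n j) t =
  (pos_pow 2 (psi t - psi (grid n j)) - pos_pow 2 (psi t - psi (grid n j.+1))) / 2.
Proof.
move=> jn t01; pose G := (Gamma (a + 1))^-1.
pose u i := (fun s => pos_pow a (psi s - psi (grid n i))).
have cu i : cont01 (u i) by exact: cont01_pos_pow.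
have c0 : cont01 (cst 0 : R -> R) by apply: continuous_subspaceT; exact: cst_continuous.
have cgu : cont01 (fun s => G * u j s + cst 0 s) by exact: cont01_lincomb.
rewrite (_ : frac_weight n j = (fun s => (- G) * u j.+1 s + (G * u j s + cst 0 s))); last first.
  by apply/funext => s; rewrite /frac_weight /u /G /cst; ring.
rewrite !psi_RLint_lincomb// psi_RLint_cst// mul0r addr0 !psi_RLint_pos_pow ?grid_itv ?ltnS ?leqW//.
rewrite !subrK (_ : 2 + 1 = 3 :> R); last by ring.
by rewrite Gamma3 /G; field; rewrite gt_eqF.
Qed.

Lemma psi_RLint_frac_sum n w t : t \in `[0, 1] ->
  psi_RLint (2 - a) psi (frac_sum n w) t = \sum_(j < n.+1)
  (pos_pow 2 (psi t - psi (grid n j)) - pos_pow 2 (psi t - psi (grid n j.+1))) / 2 * w j.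
Proof.
move=> t01; rewrite /frac_sum.
suff main k : (k <= n.+1)%N -> psi_RLint (2 - a) psi (fun s => \sum_(j < k) frac_weight n j s * w j) t =
    \sum_(j < k) (pos_pow 2 (psi t - psi (grid n j)) - pos_pow 2 (psi t - psi (grid n j.+1))) / 2 * w j /\
    cont01 (fun s => \sum_(j < k) frac_weight n j s * w j) by have [] := main n.+1 (leqnn _).
elim: k => [_|k IH kn].
  rewrite (_ : (fun _ => _) = cst 0); last by apply/funext => s; rewrite big_ord0.
  rewrite big_ord0 psi_RLint_cst// mul0r; split=> //.
  by apply: continuous_subspaceT; exact: cst_continuous.
have [IH1 IH2] := IH (ltnW kn).
rewrite (_ : (fun _ => _) = (fun t => w k * frac_weight n k t +
    \sum_(j < k) frac_weight n j t * w j)); last first.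
  by apply/funext => s; rewrite big_ord_recr/= addrC mulrC.
have ck := frac_weight_cont n k.
split; last exact: cont01_lincomb.
rewrite big_ord_recr/= psi_RLint_lincomb// IH1 psi_RLint_frac_weight//.
by rewrite addrC [w k * _]mulrC.
Qed.

End Scheme.

(** * Ultralimits of the discrete solutions *)

Section Comparison.
Context {R : realType}.

Lemma is_deriv01_nondecreasing (h h' : R -> R) (u v : R) : 0 <= u -> v <= 1 -> u <= v ->
  (forall s, s \in `[u, v] -> is_deriv01 h s (h' s)) ->
  (forall s, s \in `[u, v] -> 0 <= h' s) -> h u <= h v.
Proof.
move=> u0 v1; rewrite le_eqVlt => /predU1P[->//|uv] dh h'0.
have ch : {within `[u, v], continuous h}.
  apply/(@subspace_continuousP R `[u, v]%classic R h) => t tuv.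
  have [d d0 hd] := is_deriv01_locally_lipschitz _ _ _ (dh _ tuv).
  have l1 : 0 < `|h' t| + 1 by rewrite ltr_wpDl.
  apply/cvgrPdist_le => e e0; exists (Num.min d (e / (`|h' t| + 1))) => /=.
    by rewrite lt_min d0 divr_gt0.
  move=> s sd suv.
  have /andP[sd1 sd2] : (`|t - s| < d) && (`|t - s| < e / (`|h' t| + 1)) by rewrite -lt_min.
  have s01 : s \in `[0, 1].
    move: suv; rewrite /= !in_itv/= => /andP[us sv].
    by rewrite (le_trans u0 us) (le_trans sv v1).
  rewrite distrC (le_trans (hd _ s01 _)) 1?distrC//.
  by rewrite mulrC -ler_pdivlMr// ltW.
have [x|c cuv hc] := @MVT R h h' u v uv _ ch.
  move=> xuv; apply: is_deriv01_is_derive; last by apply: dh; exact: subset_itv_oo_cc.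
  move: xuv; rewrite !in_itv/= => /andP[ux xv].
  by rewrite (le_lt_trans u0 ux) (lt_le_trans xv v1).
rewrite -subr_ge0 hc mulr_ge0 ?subr_ge0 ?(ltW uv)//.
by apply: h'0; exact: subset_itv_oo_cc.
Qed.

(** A comparison of increments through derivatives alone; it estimates Riemann sums against a
    primitive without writing integrals. *)
Lemma is_deriv01_dist_le (h h' k k' : R -> R) (u v : R) : 0 <= u -> v <= 1 -> u <= v ->
  (forall s, s \in `[u, v] -> is_deriv01 h s (h' s)) ->
  (forall s, s \in `[u, v] -> is_deriv01 k s (k' s)) ->
  (forall s, s \in `[u, v] -> `|h' s| <= k' s) -> `|h v - h u| <= k v - k u.
Proof.
move=> u0 v1 uv dh dk hk; rewrite ler_norml; apply/andP; split.
  suff : k u - (- 1 * h u) <= k v - (- 1 * h v) by lra.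
  apply: (is_deriv01_nondecreasing (fun s => k s - (-1 * h s)) (fun s => k' s - (0 * h s + -1 * h' s))) => //.
    move=> s suv; apply: is_deriv01B; first exact: dk.
    apply: is_deriv01M; last exact: dh.
    by apply: is_derive_is_deriv01; exact: is_derive_cst.
  by move=> s /hk; rewrite ler_norml => /andP[? ?]; lra.
suff : k u - h u <= k v - h v by lra.
apply: (is_deriv01_nondecreasing (fun s => k s - h s) (fun s => k' s - h' s)) => //.
  by move=> s suv; apply: is_deriv01B; [exact: dk|exact: dh].
by move=> s /hk; rewrite ler_norml => /andP[? ?]; lra.
Qed.

Lemma cont01_filter (T : Type) (U : set_system T) {FU : Filter U} (h : R -> R)
    (s : T -> R) (s0 : R) :
  {within `[0, 1], continuous h} -> (forall n, s n \in `[0, 1]) ->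
  s0 \in `[0, 1] -> s @ U --> s0 -> (fun n => h (s n)) @ U --> h s0.
Proof.
move=> /within01_continuousP ch s01 s001 ss0; apply/cvgrPdist_le => e e0.
have [d d0 hd] := ch _ s001 _ e0; move/cvgrPdist_lt : ss0 => /(_ _ d0).
by apply: filterS => n sd; rewrite distrC hd// distrC.
Qed.

End Comparison.

Section Limit.
Context {R : realType}.
Local Notation cont01 h := {within `[0, 1], continuous h}.
Variable psi : R -> R.
Hypothesis psiC2 : C2_01 psi.
Hypothesis psi_incr : {in `[0, 1] &, {homo psi : s t / s < t}}.
Hypothesis dpsi_neq0 : {in `[0, 1], forall t, deriv01 psi t != 0}.
Variable a : R.
Hypothesis a12 : 1 < a < 2.
Local Notation p := (deriv01 psi).
Local Notation scale := (frac_scale psi a).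

Let a0 : 0 < a. Proof. by case/andP: a12 => a1 _; rewrite (lt_trans ltr01). Qed.
Let Ga0 : 0 < Gamma (a + 1). Proof. by rewrite Gamma_gt0// addr_gt0. Qed.
Let zero01 : (0 : R) \in `[0, 1]. Proof. by rewrite in_itv/= lexx ler01. Qed.
Let psi_le (s t : R) : s \in `[0, 1] -> t \in `[0, 1] -> s <= t -> psi s <= psi t.
Proof. exact: (psi_homo _ psi_incr). Qed.

Lemma frac_scale0 : scale 0 = 0.
Proof. by rewrite /frac_scale subrr pos_pow_le0// mul0r. Qed.

Lemma frac_scale_ge0 t : 0 <= scale t.
Proof. by rewrite divr_ge0 ?pos_pow_ge0// ltW. Qed.

(** As [a > 1], the power splits into [psi s - psi 0], which is O(s), and a positive power of it,
    which tends to 0. The slope of the solution at 0 is thus the one of its linear part. *)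
Lemma frac_scale_is_deriv01_0 : is_deriv01 scale 0 0.
Proof.
have d := is_deriv01_locally_lipschitz _ _ _ (psi_is_deriv01 _ psiC2 _ zero01).
case: d => d d0 hd; set C := `|p 0| + 1 in hd; have C0 : 0 < C by rewrite ltr_wpDl.
have a1 : 0 < a - 1 by case/andP: a12; lra.
have /within01_continuousP cq := cont01_pos_pow _ psiC2 (a - 1) (psi 0) a1.
apply/is_deriv01P => e e0; have e'0 : 0 < e * Gamma (a + 1) / C by rewrite divr_gt0// mulr_gt0.
have [d' d'0 hd'] := cq _ zero01 _ e'0.
exists (Num.min d d'); first by rewrite lt_min d0.
move=> s s01; rewrite lt_min => /andP[sd sd'].
have s0 : 0 <= s by move: s01; rewrite in_itv/= => /andP[].
have P0 : 0 <= psi s - psi 0 by rewrite subr_ge0 psi_le.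
rewrite frac_scale0 mul0r !subr0 ger0_norm ?frac_scale_ge0// /frac_scale ler_pdivrMr//.
rewrite pos_powE// -(mulr_powRB1 P0 a0).
have h1 := hd _ s01 sd; rewrite ger0_norm// in h1.
have := hd' _ s01 sd'; rewrite subrr [pos_pow _ 0]pos_pow_le0// subr0 ger0_norm ?pos_pow_ge0//.
rewrite pos_powE// => h2.
apply: (le_trans (ler_pM P0 (powR_ge0 _ _) h1 h2)); rewrite subr0.
by rewrite le_eqVlt; apply/orP; left; apply/eqP; field; rewrite gt_eqF.
Qed.

Section GridSum.
Variables (F P Q : R -> R).
Hypothesis dP : {in `[0, 1], forall t, is_deriv01 P t (p t * F t)}.
Hypothesis dQ : {in `[0, 1], forall t, is_deriv01 Q t (p t * psi t * F t)}.
Hypotheses (P0 : P 0 = 0) (Q0 : Q 0 = 0).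

(* The sum is a Riemann-type sum for the integral of [p * (psi t - psi) * F] over [0, t],
   which is [psi t * P t - Q t]; both are compared on each grid interval cut at [t]. *)
Lemma grid_sum_close n w e t : t \in `[0, 1] ->
  (forall j s, (j <= n)%N -> s \in `[grid n j, grid n j.+1] -> `|w j - F s| <= e) ->
  `|\sum_(j < n.+1) (pos_pow 2 (psi t - psi (grid n j)) -
       pos_pow 2 (psi t - psi (grid n j.+1))) / 2 * w j - (psi t * P t - Q t)|
  <= e * ((psi t - psi 0) ^+ 2 / 2).
Proof.
move=> t01 wF; have /andP[t0 t1] : 0 <= t <= 1 by move: t01; rewrite in_itv.
(* Cutting the grid at [t] corresponds to the truncation in [pos_pow 2]. In the variable [s], [V] is
   a primitive of the kernel [p s * (psi t - psi s)] and [G] one of the kernel times [F]. *)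
pose q j := Num.min t (grid n j).
pose V s := - ((psi t - psi s) * (psi t - psi s) / 2).
pose G s := psi t * P s - Q s.
have q01 j : (j <= n.+1)%N -> q j \in `[0, 1].
  move=> jn; have := @grid_itv R n j jn; rewrite !in_itv/= /q => /andP[g0 g1].
  by rewrite le_min t0 g0 ge_min t1.
have qV j : (j <= n.+1)%N -> pos_pow 2 (psi t - psi (grid n j)) / 2 = - V (q j).
  move=> jn; rewrite /V opprK /q; have [tg|gt] := leP t (grid n j).
    by rewrite pos_pow_le0 ?subrr ?mul0r// subr_le0 psi_le// grid_itv.
  rewrite pos_powE ?subr_ge0 ?psi_le ?grid_itv ?(ltW gt)//.
  by rewrite powR_mulrn ?expr2// subr_ge0 psi_le ?grid_itv ?(ltW gt).
have dV s : s \in `[0, 1] -> is_deriv01 V s (p s * (psi t - psi s)).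
  move=> s01; have dc (c : R) : is_deriv01 (cst c) s 0.
    by apply: is_derive_is_deriv01; exact: is_derive_cst.
  have d1 := is_deriv01B _ _ _ _ _ (dc (psi t)) (psi_is_deriv01 _ psiC2 _ s01).
  have d2 := is_deriv01M _ _ _ _ _ d1 (is_deriv01M _ _ _ _ _ d1 (dc (- 2^-1))).
  rewrite (_ : p s * _ = (0 - p s) * ((cst (psi t) s - psi s) * cst (- 2^-1) s) +
    (cst (psi t) s - psi s) * ((0 - p s) * cst (- 2^-1) s + (cst (psi t) s - psi s) * 0)).
    by apply: eq_is_deriv01 d2 => // u _; rewrite /V /cst; ring.
  by rewrite /cst; field.
have dG s : s \in `[0, 1] -> is_deriv01 G s (p s * (psi t - psi s) * F s).
  move=> s01; have dc : is_deriv01 (cst (psi t)) s 0.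
    by apply: is_derive_is_deriv01; exact: is_derive_cst.
  have := is_deriv01B _ _ _ _ _ (is_deriv01M _ _ _ _ _ dc (dP _ s01)) (dQ _ s01).
  by rewrite (_ : _ - _ = p s * (psi t - psi s) * F s)//; rewrite /cst; ring.
have q0 : q 0%N = 0 by rewrite /q grid0; apply: min_r.
have qS : q n.+1 = t by rewrite /q gridS; apply: min_l.
have tele (h : R -> R) : h t - h 0 = \sum_(j < n.+1) (h (q j.+1) - h (q j)).
  suff main k : \sum_(j < k) (h (q j.+1) - h (q j)) = h (q k) - h (q 0%N) by rewrite main qS q0.
  by elim: k => [|k IH]; [rewrite big_ord0 subrr|rewrite big_ord_recr/= IH addrC addrA subrK].
have -> : psi t * P t - Q t = G t - G 0 by rewrite /G P0 Q0; ring.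
have -> : (psi t - psi 0) ^+ 2 / 2 = V t - V 0 by rewrite /V; field.
rewrite (tele G) (tele V) -sumrB mulr_sumr; apply: (le_trans (ler_norm_sum _ _ _)).
apply: ler_sum => j _; have jn : (j <= n)%N by rewrite -ltnS.
rewrite mulrBl (qV j (leqW jn)) (qV j.+1 jn).
have g_le : grid n j <= grid n j.+1 :> R by rewrite grid_homo.
have [tg|gt] := leP t (grid n j).
  have -> : q j = t by apply: min_l.
  have -> : q j.+1 = t by apply: min_l; exact: le_trans g_le.
  by rewrite !subrr mul0r subrr normr0 mulr0.
have qj : q j = grid n j by apply: min_r; exact: ltW.
have q_le : q j <= q j.+1 by rewrite qj /q le_min (ltW gt).
have qS1 : q j.+1 <= 1 by have := q01 j.+1 jn; rewrite in_itv/= => /andP[].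
have qj0 : 0 <= q j by have := q01 j (leqW jn); rewrite in_itv/= => /andP[].
have sub s : s \in `[q j, q j.+1] -> [/\ s \in `[0, 1], s <= t & s \in `[grid n j, grid n j.+1]].
  rewrite !in_itv/= => /andP[qs sq]; split.
  - by rewrite (le_trans qj0 qs) (le_trans sq qS1).
  - by rewrite (le_trans sq)// /q ge_min lexx.
  - by rewrite -qj qs (le_trans sq)// /q ge_min lexx orbT.
have dc (c s : R) : is_deriv01 (cst c) s 0 by apply: is_derive_is_deriv01; exact: is_derive_cst.
(* On a cell [V * w j - G] has derivative kernel times [w j - F s], which is dominated by the
   derivative of [V * e]. *)
have := is_deriv01_dist_le (fun s => V s * cst (w j) s - G s)
   (fun s => p s * (psi t - psi s) * cst (w j) s + V s * 0 - p s * (psi t - psi s) * F s)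
   (fun s => V s * cst e s) (fun s => p s * (psi t - psi s) * cst e s + V s * 0) _ _ qj0 qS1 q_le.
rewrite (_ : (- V (q j) - - V (q j.+1)) * w j - (G (q j.+1) - G (q j)) =
  V (q j.+1) * cst (w j) (q j.+1) - G (q j.+1) - (V (q j) * cst (w j) (q j) - G (q j))); last first.
  by rewrite /cst; ring.
rewrite (_ : e * _ = V (q j.+1) * cst e (q j.+1) - V (q j) * cst e (q j)); last first.
  by rewrite /cst; ring.
apply.
- move=> s /sub[s01 _ _]; apply: is_deriv01B; last exact: dG.
  by apply: is_deriv01M; [exact: dV|exact: dc].
- move=> s /sub[s01 _ _].
  by apply: is_deriv01M; [exact: dV|exact: dc].
move=> s /sub[s01 st sg]; rewrite /cst !mulr0 !addr0 -mulrBr normrM ger0_norm.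
  by rewrite ler_wpM2l ?wF// mulr_ge0 ?subr_ge0 ?psi_le// ltW// dpsi_gt0.
by rewrite mulr_ge0 ?subr_ge0 ?psi_le// ltW// dpsi_gt0.
Qed.

End GridSum.

Variable U : set_system nat.
Hypothesis (UU : UltraFilter U) (sU : \oo `<=` U).

Let PU : ProperFilter U. Proof. exact: ultra_proper. Qed.
Let FU : Filter U. Proof. exact: filter_filter. Qed.

Section Component.
Variables (F z : R -> R) (w : nat -> nat -> R) (M : R).
Hypothesis cF : cont01 F.
Hypothesis wM : forall n j, (j <= n)%N -> `|w n j| <= M.
Hypothesis wF : forall e, 0 < e -> \forall n \near U, forall j, (j <= n)%N ->
  `|w n j - F (grid n j)| <= e.
Hypothesis Zz : forall t, t \in `[0, 1] -> (fun n => frac_sum psi a n (w n) t) @ U --> z t.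

Let limit_le (u : nat -> R) (l B : R) : u @ U --> l -> (forall n, `|u n| <= B) -> `|l| <= B.
Proof.
move=> ul uB; apply: (@ler_cvg_to nat U PU R (fun n => `|u n|) (fun=> B)).
- by apply: cvg_norm; exact: ul.
- exact: cvg_cst.
- exact: filterE.
Qed.

Lemma frac_limit_bound t : t \in `[0, 1] -> `|z t| <= M * scale t.
Proof.
move=> t01; apply: (limit_le _ _ _ (Zz _ t01)) => n.
by apply: frac_sum_bound => // j; exact: wM.
Qed.

Lemma frac_limit_modulus s t : s \in `[0, 1] -> t \in `[0, 1] ->
  `|z t - z s| <= M * `|scale t - scale s|.
Proof.
move=> s01 t01; apply: (limit_le _ _ _ (cvgB (Zz _ t01) (Zz _ s01))) => n.
by apply: frac_sum_modulus => // j; exact: wM.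
Qed.

Let M0 : 0 <= M. Proof. by rewrite (le_trans _ (wM 0%N 0%N (leqnn _))). Qed.

Lemma frac_limit_cont : cont01 z.
Proof.
have /within01_continuousP cs := frac_scale_cont _ psiC2 _ a12.
apply/within01_continuousP => t t01 e e0.
have M1 : 0 < M + 1 by rewrite ltr_wpDl.
have [d d0 hd] := cs _ t01 (e / (M + 1)) (divr_gt0 e0 M1).
exists d => // s s01 sd; rewrite (le_trans (frac_limit_modulus _ _ t01 s01))//.
have h := hd _ s01 sd; apply: (@le_trans _ _ ((M + 1) * (e / (M + 1)))).
  by apply: ler_pM => //; rewrite lerDl.
by rewrite mulrC divfK// gt_eqF.
Qed.

(** Pointwise convergence and a common modulus of continuity give uniform convergence. Along a
    selection [s n] with limit [s0], the error splits at [s0] into two moduli and one pointwise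
    error. *)
Lemma frac_sum_uniform e : 0 < e -> \forall n \near U, forall t, t \in `[0, 1] ->
  `|frac_sum psi a n (w n) t - z t| <= e.
Proof.
move=> e0; pose Q n := [set t | `|frac_sum psi a n (w n) t - z t| <= e].
apply: (@near_forall_selection U UU R (fun=> [set t | t \in `[0, 1]]) Q); first by move=> _; exists 0.
move=> s s01; have [s0 s001 ss0] := @ultra_bounded_cvg R U UU s 0 1 s01.
have c1 : (fun n => M * `|scale (s n) - scale s0| + `|frac_sum psi a n (w n) s0 - z s0| +
    `|z s0 - z (s n)|) @ U --> M * `|scale s0 - scale s0| + `|z s0 - z s0| + `|z s0 - z s0|.
  have cs := @cont01_filter R nat U FU _ _ _ (frac_scale_cont _ psiC2 _ a12) s01 s001 ss0.
  have cz := @cont01_filter R nat U FU _ _ _ frac_limit_cont s01 s001 ss0.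
  apply: cvgD; first apply: cvgD.
  - by apply: cvgMr; apply: cvg_norm; apply: cvgB; [exact: cs|exact: cvg_cst].
  - by apply: cvg_norm; apply: cvgB; [exact: Zz|exact: cvg_cst].
  - by apply: cvg_norm; apply: cvgB; [exact: cvg_cst|exact: cz].
rewrite !subrr normr0 mulr0 !addr0 in c1.
move/cvgrPdist_le : c1 => /(_ _ e0); apply: filterS => n; rewrite sub0r normrN => h.
rewrite /Q/=; apply: le_trans (le_trans (ler_norm _) h).
have := @frac_sum_modulus R psi psi_incr a a12 n (w n) M s0 (s n) s001 (s01 n) (wM n).
set A := frac_sum _ _ _ _ (s n); set B := frac_sum _ _ _ _ s0 => hAB.
have -> : A - z (s n) = (A - B) + (B - z s0) + (z s0 - z (s n)) by ring.
apply: (le_trans (ler_normD _ _)); rewrite lerD2r.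
by apply: (le_trans (ler_normD _ _)); rewrite lerD2r.
Qed.

(** [wF] controls the data at left end points of cells only. A selected point and the left end of
    its cell have the same limit, and continuity of [F] extends the control to the whole cell. *)
Lemma frac_weights_near_limit e : 0 < e -> \forall n \near U, forall j s, (j <= n)%N ->
  s \in `[grid n j, grid n j.+1] -> `|w n j - F s| <= e.
Proof.
move=> e0; have e20 : 0 < e / 2 by rewrite divr_gt0.
pose D n := [set js : nat * R | (js.1 <= n)%N /\ js.2 \in `[grid n js.1, grid n js.1.+1]].
pose Q n := [set js : nat * R | `|F (grid n js.1) - F js.2| <= e / 2].
have D0 n : D n !=set0.
  by exists (0%N, 0); split => //=; rewrite in_itv/= grid0 lexx -(grid0 n) grid_homo.
have := @near_forall_selection U UU _ D Q D0.
have hsel (s : nat -> nat * R) : (forall n, D n (s n)) -> \forall n \near U, Q n (s n).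
  move=> Ds; have s01 n : (s n).2 \in `[0, 1].
    have [j1 j2] := Ds n; move: j2; have := @grid_itv R n (s n).1 (leqW j1).
    have := @grid_itv R n (s n).1.+1 j1; rewrite !in_itv/= => /andP[_ r1] /andP[l0 _] /andP[l r].
    by rewrite (le_trans l0 l) (le_trans r r1).
  have g01 n : grid n (s n).1 \in `[(0 : R), 1] by have [j1 _] := Ds n; exact/grid_itv/leqW.
  have [s0 s001 ss0] := @ultra_bounded_cvg R U UU _ 0 1 s01.
  have gs0 : (fun n => grid n (s n).1) @ U --> s0.
    apply: (@cvg_shrink R U PU _ _ s0 1 sU ss0) => n; have [_] := Ds n.
    have -> : grid n (s n).1.+1 = grid n (s n).1 + 1 / n.+1%:R :> R.
      by rewrite /grid -[(s n).1.+1%:R]natr1 mulrDl.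
    rewrite in_itv/= => /andP[l r].
    by rewrite ger0_norm ?subr_ge0// lerBlDl.
  have c1 := @cont01_filter R nat U FU _ _ _ cF g01 s001 gs0.
  have c2 := @cont01_filter R nat U FU _ _ _ cF s01 s001 ss0.
  have : (fun n => F (grid n (s n).1) - F (s n).2) @ U --> F s0 - F s0.
    by apply: cvgB; [exact: c1|exact: c2].
  rewrite subrr => /cvgrPdist_le/(_ _ e20).
  by apply: filterS => n; rewrite sub0r normrN.
move=> /(_ hsel) nQ; have nw := wF _ e20.
near=> n => j s jn js.
have h1 : `|w n j - F (grid n j)| <= e / 2 by move: j jn {js}; near: n.
have h2 : `|F (grid n j) - F s| <= e / 2.
  have : forall js, D n js -> Q n js by near: n.
  by move=> /(_ (j, s)); apply.
rewrite -[w n j](subrK (F (grid n j))) -addrA (le_trans (ler_normD _ _))//.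
by rewrite [leRHS]splitr lerD.
Unshelve. all: by end_near. Qed.

(** [M] is a crude bound on the data, which will depend on the truncation level. The final estimate
    needs a bound on [F], the right-hand side along the limit. *)
Lemma frac_limit_sharp_bound B t : {in `[0, 1], forall s, `|F s| <= B} -> t \in `[0, 1] ->
  `|z t| <= B * scale t.
Proof.
move=> FB t01; apply/ler_addgt0Pr => e e0.
have s1 : 0 < scale t + 1 by rewrite ltr_wpDl// frac_scale_ge0.
have e'0 : 0 < e / (scale t + 1) by rewrite divr_gt0.
apply: (@ler_cvg_to nat U PU R (fun n => `|frac_sum psi a n (w n) t|) (fun=> B * scale t + e)).
- by apply: cvg_norm; exact: Zz.
- exact: cvg_cst.
have := wF _ e'0; apply: filterS => n nw.
apply: (@le_trans _ _ ((B + e / (scale t + 1)) * scale t)).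
  apply: frac_sum_bound => // j jn; have gj : grid n j \in `[(0 : R), 1] by exact/grid_itv/leqW.
  rewrite -[w n j](subrK (F (grid n j))) addrC (le_trans (ler_normD _ _))// lerD ?FB//.
  exact: nw.
rewrite mulrDl lerD2l -mulrA ler_piMr ?(ltW e0)// mulrC ler_pdivrMr// mul1r lerDl.
exact: ler01.
Qed.

Lemma frac_limit_0 : z 0 = 0.
Proof.
by have := frac_limit_bound 0 zero01; rewrite frac_scale0 mulr0 normr_le0 => /eqP.
Qed.

Lemma frac_limit_is_deriv01_0 : is_deriv01 z 0 0.
Proof.
have M1 : 0 < M + 1 by rewrite ltr_wpDl.
apply/is_deriv01P => e e0.
have /is_deriv01P/(_ _ (divr_gt0 e0 M1))[d d0 hd] := frac_scale_is_deriv01_0.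
exists d => // s s01 sd; rewrite frac_limit_0 mul0r !subr0.
have := hd _ s01 sd; rewrite frac_scale0 mul0r !subr0 ger0_norm ?frac_scale_ge0// => h.
apply: (le_trans (frac_limit_bound _ s01)).
apply: (@le_trans _ _ ((M + 1) * (e / (M + 1) * `|s|))).
  by apply: ler_pM => //; [exact: frac_scale_ge0|rewrite lerDl].
by rewrite mulrA [(M + 1) * _]mulrC divfK// gt_eqF.
Qed.

(** With [P] and [Q] primitives of [p * F] and [p * psi * F], the function [psi * P - Q] is the
    twofold iterated integral: on differentiating, the two terms in [p * psi * F] cancel and [p * P]
    remains. *)
Lemma psi_RLint_frac_limit : exists P : R -> R,
  {in `[0, 1], forall t, is_deriv01 P t (p t * F t)} /\
  exists2 H : R -> R, {in `[0, 1], psi_RLint (2 - a) psi z =1 H} &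
    {in `[0, 1], forall t, is_deriv01 H t (p t * P t)}.
Proof.
have cp := dpsi_continuous _ psiC2; have cpsi := psi_continuous _ psiC2.
have [P P0 dP] := within01_primitive _ (cont01M _ _ cp cF).
have [Q Q0 dQ] := within01_primitive _ (cont01M _ _ (cont01M _ _ cp cpsi) cF).
exists P; split => //; exists (fun t => psi t * P t - Q t); last first.
  move=> t t01.
  have := is_deriv01B _ _ _ _ _
    (is_deriv01M _ _ _ _ _ (psi_is_deriv01 _ psiC2 _ t01) (dP _ t01)) (dQ _ t01).
  by rewrite (_ : _ - _ = p t * P t)//; ring.
move=> t t01; apply/eqP; rewrite -subr_eq0 -normr_eq0; apply/negPn/negP => D0.
set D := `|_| in D0; have {}D0 : 0 < D by rewrite lt_neqAle eq_sym D0 normr_ge0.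
(* [C1] and [C2] are the constants of [psi_RLint_close] and [grid_sum_close]; [e] below is chosen so
   that both errors together are at most [D / 2], while they should add up to at least [D > 0]. *)
pose C1 := (psi t - psi 0) `^ (2 - a) / Gamma (2 - a + 1).
pose C2 := (psi t - psi 0) ^+ 2 / 2.
have b0 : 0 < 2 - a by case/andP: a12; lra.
have C10 : 0 <= C1 by rewrite divr_ge0 ?powR_ge0// ltW// Gamma_gt0// addr_gt0.
have C20 : 0 <= C2 by rewrite divr_ge0// sqr_ge0.
have C0 : 0 < C1 + C2 + 1 by rewrite ltr_wpDl// addr_ge0.
pose e := D / 2 / (C1 + C2 + 1); have e0 : 0 < e by rewrite !divr_gt0.
have [n [n1 n2]] := filter_ex (filterI (frac_sum_uniform _ e0) (frac_weights_near_limit _ e0)).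
have b01 : 0 < 2 - a < 1 by case/andP: a12 => ? ?; apply/andP; split; lra.
have h1 := @psi_RLint_close R psi psiC2 psi_incr dpsi_neq0 (2 - a) b01 (frac_sum psi a n (w n)) z e t t01
  (frac_sum_cont _ psiC2 _ a12 _ _) frac_limit_cont n1.
have h2 := @grid_sum_close F P Q dP dQ P0 Q0 n (w n) e t t01 n2.
rewrite -(@psi_RLint_frac_sum R psi psiC2 psi_incr dpsi_neq0 a a12)// in h2.
have : D <= e * C1 + e * C2.
  apply: le_trans (lerD h1 h2); rewrite [`|psi_RLint _ _ _ t - psi_RLint _ _ z t|]distrC.
  apply: le_trans (ler_normD _ _); rewrite /D le_eqVlt; apply/orP; left.
  by apply/eqP; congr (`| _ |); ring.
have : e * (C1 + C2 + 1) = D / 2 by rewrite divfK// gt_eqF.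
rewrite !mulrDr mulr1; lra.
Qed.

(** Since [z] and its derivative vanish at 0, the Taylor polynomial in the Caputo derivative is
    exactly the linear part and its rest is [z]. The two [psi]-derivatives of the integral of [z]
    are then [P] and [F]. *)
Lemma frac_limit_Caputo c x : {in `[0, 1], forall t, x t = c * (psi t - psi 0) + z t} ->
  psi_Caputo_eq a psi x F.
Proof.
move=> xE; have p0 : p 0 != 0 by exact: dpsi_neq0.
have dx0 : is_deriv01 x 0 (c * p 0).
  have dc (k : R) : is_deriv01 (cst k) 0 0 by apply: is_derive_is_deriv01; exact: is_derive_cst.
  have := is_deriv01B _ _ _ _ _
    (is_deriv01M _ _ _ _ _ (dc c) (is_deriv01B _ _ _ _ _ (psi_is_deriv01 _ psiC2 _ zero01) (dc (psi 0))))
    (is_deriv01M _ _ _ _ _ (dc (-1)) frac_limit_is_deriv01_0).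
  rewrite (_ : _ - _ = c * p 0); last by rewrite /cst; ring.
  by apply: eq_is_deriv01 => // s s01; rewrite xE// /cst; ring.
have restE : {in `[0, 1], psi_taylor_rest psi x =1 z}.
  move=> t t01; rewrite /psi_taylor_rest !big_ord_recl big_ord0 /=.
  rewrite /psi_deriv (is_deriv01E _ _ _ zero01 dx0) mulfK//.
  rewrite (xE _ zero01) (xE _ t01) frac_limit_0 fact0 /bump /= !divr1 expr0 expr1; ring.
have [P [dP [H IH dH]]] := psi_RLint_frac_limit.
set I := psi_RLint (2 - a) psi (psi_taylor_rest psi x).
have I_H : {in `[0, 1], H =1 I}.
  move=> t t01; rewrite -IH// /I /psi_RLint; congr (_ * _).
  apply: eq_Rintegral => s /set_mem /=; rewrite in_itv/= => /andP[s0 st].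
  rewrite restE// in_itv/= s0 (le_trans st)//.
  by move: t01; rewrite in_itv/= => /andP[].
have dI t : t \in `[0, 1] -> is_deriv01 I t (p t * P t).
  by move=> t01; apply: (eq_is_deriv01 H) => //; exact: dH.
have pn0 t : t \in `[0, 1] -> p t != 0 by exact: dpsi_neq0.
have J_P : {in `[0, 1], P =1 psi_deriv psi I}.
  by move=> t t01; rewrite /psi_deriv (is_deriv01E _ _ _ t01 (dI _ t01)) mulrC mulKf// pn0.
have dJ t : t \in `[0, 1] -> is_deriv01 (psi_deriv psi I) t (p t * F t).
  by move=> t01; apply: (eq_is_deriv01 P) => //; exact: dP.
split; first split.
- exact: is_deriv01_derivable01 dx0.
- by move=> t t01; split; [exact: is_deriv01_derivable01 (dI _ t01)|exact: is_deriv01_derivable01 (dJ _ t01)].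
- move=> t t01; rewrite /psi_Caputo /psi_RLderiv /psi_derivn /= -/I.
  by rewrite /psi_deriv -/(psi_deriv psi I) (is_deriv01E _ _ _ t01 (dJ _ t01)) mulrC mulKf// pn0.
Qed.

End Component.
End Limit.

(** * The coupled system *)

Section CoupledSystem.
Context {R : realType}.
Local Notation cont01 h := {within `[0, 1], continuous h}.
Variable psi : R -> R.
Hypothesis psiC2 : C2_01 psi.
Hypothesis psi_incr : {in `[0, 1] &, {homo psi : s t / s < t}}.
Hypothesis dpsi_neq0 : {in `[0, 1], forall t, deriv01 psi t != 0}.
Local Notation Psi t := (psi t - psi 0).

Let zero01 : (0 : R) \in `[0, 1]. Proof. by rewrite in_itv/= lexx ler01. Qed.
Let one01 : (1 : R) \in `[0, 1]. Proof. by rewrite in_itv/= lexx ler01. Qed.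

Let psi_ge0 t : t \in `[0, 1] -> 0 <= Psi t.
Proof.
move=> t01; rewrite subr_ge0; apply: (psi_homo _ psi_incr) => //.
by move: t01; rewrite in_itv/= => /andP[].
Qed.

Let psi_le1 t : t \in `[0, 1] -> Psi t <= Psi 1.
Proof.
move=> t01; rewrite lerD2r; apply: (psi_homo _ psi_incr) => //.
by move: t01; rewrite in_itv/= => /andP[].
Qed.

(** Clamping the state gives a bounded field; clamping the time makes it continuous everywhere,
    although [f] is controlled only for times in [0, 1]. *)
Definition clamp_field (rho : R) (f : R -> R -> R -> R) (t x y : R) : R :=
  f (clamp 0 1 t) (clamp (- rho) rho x) (clamp (- rho) rho y).

(** Arbitrary filters, because three kinds occur below: neighbourhoods in the plane of slopes,
    neighbourhoods within [0, 1], and the ultrafilter. *)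
Lemma clamp_field_continuous rho f :
  {within `[0, 1] `*` [set: R * R], continuous (fun q : R * (R * R) => f q.1 q.2.1 q.2.2)} ->
  forall (T : Type) (U : set_system T) (FU : Filter U) (t x y : T -> R) (t0 x0 y0 : R),
  t @ U --> t0 -> x @ U --> x0 -> y @ U --> y0 ->
  (fun n => clamp_field rho f (t n) (x n) (y n)) @ U --> clamp_field rho f t0 x0 y0.
Proof.
move=> /(@subspace_continuousP (R * (R * R))%type _ R _) cf T U FU t x y t0 x0 y0 tt0 xx0 yy0.
pose q n : R * (R * R) := (clamp 0 1 (t n), (clamp (- rho) rho (x n), clamp (- rho) rho (y n))).
pose q0 : R * (R * R) := (clamp 0 1 t0, (clamp (- rho) rho x0, clamp (- rho) rho y0)).
have cc a b (u : T -> R) u0 : u @ U --> u0 -> (fun n => clamp a b (u n)) @ U --> clamp a b u0.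
  by move=> uu0; apply: continuous_cvg; [exact: clamp_continuous|].
have qq0 : q @ U --> q0.
  apply: (@cvg_pair _ _ _ U (nbhs (clamp 0 1 t0)) (nbhs q0.2) _ _ _ (fun n => clamp 0 1 (t n))
    (fun n => (q n).2)); first exact: cc.
  by apply: (@cvg_pair _ _ _ U (nbhs q0.2.1) (nbhs q0.2.2) _ _ _ (fun n => (q n).2.1)
    (fun n => (q n).2.2)); exact: cc.
have D (u v w : R) : (`[0, 1] `*` [set: R * R]) (clamp 0 1 u, (v, w)).
  by split => //=; exact: clamp_itv.
have := cf q0 (D _ _ _) => cq; apply: cvg_trans cq => A /= nA.
have : U (q @^-1` (fun z => (`[0, 1] `*` [set: R * R]) z -> A (f z.1 z.2.1 z.2.2))) by exact: qq0.
by move=> h; apply: (@filterS _ U _ _ _ _ h) => n hn; exact: (hn (D _ _ _)).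
Qed.

Section TwoEquations.
Variables (alpha beta : R).
Hypotheses (alpha12 : 1 < alpha < 2) (beta12 : 1 < beta < 2).
Variables (F G : R -> R -> R -> R) (MF MG : R).
Hypothesis cF : forall (T : Type) (U : set_system T) (FU : Filter U) (t x y : T -> R) (t0 x0 y0 : R),
  t @ U --> t0 -> x @ U --> x0 -> y @ U --> y0 ->
  (fun n => F (t n) (x n) (y n)) @ U --> F t0 x0 y0.
Hypothesis cG : forall (T : Type) (U : set_system T) (FU : Filter U) (t x y : T -> R) (t0 x0 y0 : R),
  t @ U --> t0 -> x @ U --> x0 -> y @ U --> y0 ->
  (fun n => G (t n) (x n) (y n)) @ U --> G t0 x0 y0.
Hypothesis bF : forall t x y, `|F t x y| <= MF.
Hypothesis bG : forall t x y, `|G t x y| <= MG.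

Lemma frac_sum_causal a n i w w' : 1 < a < 2 -> (i <= n)%N ->
  (forall j, (j < i)%N -> w j = w' j) ->
  frac_sum psi a n w (grid n i) = frac_sum psi a n w' (grid n i).
Proof.
move=> a12 i_n ww'; apply: eq_bigr => j _; have [ji|ij] := ltnP j i; first by rewrite ww'.
have ijn : (i <= j <= n)%N by rewrite ij -ltnS ltn_ord.
by rewrite (frac_weight_causal psi psi_incr a a12 n j i ijn) !mul0r.
Qed.

Lemma frac_sum_param_continuous a n (w : R * R -> nat -> R) t :
  (forall j, (j <= n)%N -> continuous (fun p => w p j)) ->
  continuous (fun p => frac_sum psi a n (w p) t).
Proof.
move=> cw; rewrite /frac_sum.
suff main k : (k <= n.+1)%N -> continuous (fun p => \sum_(j < k) frac_weight psi a n j t * w p j).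
  exact: main.
elim: k => [_|k IH kn].
  rewrite (_ : (fun _ => _) = cst 0); first exact: cst_continuous.
  by apply/funext => p; rewrite big_ord0.
rewrite (_ : (fun _ => _) = (fun p => \sum_(j < k) frac_weight psi a n j t * w p j +
    frac_weight psi a n k t * w p k)); last by apply/funext => p; rewrite big_ord_recr.
move=> p; apply: cvgD; first exact: (IH (ltnW kn)).
by apply: cvgMr; exact: cw.
Qed.

(* The explicit scheme: the values at the grid points are computed from left to right and
   depend continuously on the slopes [p] of the linear parts. *)
Lemma scheme_exists n : exists v : R * R -> nat -> R * R,
  (forall i, continuous (fun p => v p i)) /\
  forall p i, (i <= n)%N ->
  (v p i).1 = p.1 * Psi (grid n i) +
    frac_sum psi alpha n (fun j => F (grid n j) (v p j).1 (v p j).2) (grid n i) /\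
  (v p i).2 = p.2 * Psi (grid n i) +
    frac_sum psi beta n (fun j => G (grid n j) (v p j).1 (v p j).2) (grid n i).
Proof.
suff main k : (k <= n.+1)%N -> exists v : R * R -> nat -> R * R,
  (forall i, continuous (fun p => v p i)) /\
  forall p i, (i < k)%N ->
  (v p i).1 = p.1 * Psi (grid n i) +
    frac_sum psi alpha n (fun j => F (grid n j) (v p j).1 (v p j).2) (grid n i) /\
  (v p i).2 = p.2 * Psi (grid n i) +
    frac_sum psi beta n (fun j => G (grid n j) (v p j).1 (v p j).2) (grid n i).
  by have [v [cv hv]] := main n.+1 (leqnn _); exists v; split => // p i i_n; apply: hv.
elim: k => [_|k IH kn].
  by exists (fun _ _ => (0, 0)); split => // i; exact: cst_continuous.
have [v [cv hv]] := IH (ltnW kn).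
pose u p : R * R := (p.1 * Psi (grid n k) +
    frac_sum psi alpha n (fun j => F (grid n j) (v p j).1 (v p j).2) (grid n k),
  p.2 * Psi (grid n k) +
    frac_sum psi beta n (fun j => G (grid n j) (v p j).1 (v p j).2) (grid n k)).
have c1 : continuous (fst : R * R -> R) by move=> p; exact: cvg_fst.
have c2 : continuous (snd : R * R -> R) by move=> p; exact: cvg_snd.
have cv1 j : continuous (fun p => (v p j).1).
  by move=> p; apply: continuous_comp; [exact: cv|exact: c1].
have cv2 j : continuous (fun p => (v p j).2).
  by move=> p; apply: continuous_comp; [exact: cv|exact: c2].
exists (fun p i => if i == k then u p else v p i); split.
  move=> i; case: eqP => _; last exact: cv.
  move=> p; apply: (@cvg_pair _ _ _ (nbhs p) (nbhs (u p).1) (nbhs (u p).2) _ _ _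
    (fun p => (u p).1) (fun p => (u p).2)).
    apply: cvgD; first by apply: cvgMl; exact: c1.
    apply: frac_sum_param_continuous => j _ q.
    by apply: cF; [exact: cvg_cst|exact: cv1|exact: cv2].
  apply: cvgD; first by apply: cvgMl; exact: c2.
  apply: frac_sum_param_continuous => j _ q.
  by apply: cG; [exact: cvg_cst|exact: cv1|exact: cv2].
move=> p i; rewrite ltnS => ik; have i_n : (i <= n)%N by exact: leq_trans ik _.
set v' := fun j => if j == k then u p else v p j.
(* The new sequence is altered at index [k] only, and by causality the sum at grid point [i <= k]
   does not see that index. *)
have vv' j : (j < i)%N -> v' j = v p j.
  by move=> ji; rewrite /v' ltn_eqF// (leq_trans ji).
have eF := frac_sum_causal alpha n i (fun j => F (grid n j) (v' j).1 (v' j).2)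
   (fun j => F (grid n j) (v p j).1 (v p j).2) alpha12 i_n.
have eG := frac_sum_causal beta n i (fun j => G (grid n j) (v' j).1 (v' j).2)
   (fun j => G (grid n j) (v p j).1 (v p j).2) beta12 i_n.
rewrite -/(v' i) [in X in X /\ _]eF; last by move=> j /vv' ->.
rewrite [in X in _ /\ X]eG; last by move=> j /vv' ->.
rewrite /v'.
have [->//|ik'] := eqVneq i k; apply: hv.
by rewrite ltn_neqAle ik'.
Qed.

Lemma frac_sum_limit a (U : set_system nat) (w : nat -> nat -> R) M : 1 < a < 2 ->
  UltraFilter U -> (forall n j, (j <= n)%N -> `|w n j| <= M) ->
  exists z : R -> R, forall t, t \in `[0, 1] -> (fun n => frac_sum psi a n (w n) t) @ U --> z t.
Proof.
move=> a12 UU wM; have /choice[z hz] (t : R) : exists l : R, t \in `[0, 1] ->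
    (fun n => frac_sum psi a n (w n) t) @ U --> l; last by exists z.
have [t01|t01] := boolP (t \in `[0, 1]); last by exists 0.
pose B := M * frac_scale psi a t.
have [n|l _ hl] := @ultra_bounded_cvg R U UU (fun n => frac_sum psi a n (w n) t) (- B) B.
  rewrite in_itv/= -ler_norml.
  by apply: (frac_sum_bound psi psi_incr a a12 n (w n) M t t01) => j; exact: wM.
by exists l.
Qed.

(* Brouwer's theorem chooses the slopes so that the discrete solution satisfies the boundary
   conditions; an ultralimit of discrete solutions solves the system. *)
Lemma two_equations_solution (eta xi lambda mu : R) :
  eta \in `[0, 1] -> xi \in `[0, 1] ->
  lambda * Psi eta - Psi 1 != 0 -> mu * Psi xi - Psi 1 != 0 ->
  exists (c d : R) (x y zx zy : R -> R), [/\ cont01 x, cont01 y,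
    psi_Caputo_eq alpha psi x (fun t => F t (x t) (y t)),
    psi_Caputo_eq beta psi y (fun t => G t (x t) (y t)) &
  [/\ [/\ (forall t, x t = c * Psi t + zx t), zx 0 = 0,
        (forall B, {in `[0, 1], forall s, `|F s (x s) (y s)| <= B} ->
          {in `[0, 1], forall t, `|zx t| <= B * frac_scale psi alpha t}) &
        c * (lambda * Psi eta - Psi 1) = zx 1 - lambda * zx eta] &
      [/\ (forall t, y t = d * Psi t + zy t), zy 0 = 0,
        (forall B, {in `[0, 1], forall s, `|G s (x s) (y s)| <= B} ->
          {in `[0, 1], forall t, `|zy t| <= B * frac_scale psi beta t}) &
        d * (mu * Psi xi - Psi 1) = zy 1 - mu * zy xi]]].
Proof.
move=> eta01 xi01; set D1 := _ - Psi 1 => D1_neq0; set D2 := _ - Psi 1 => D2_neq0.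
have [U UU sU] := ex_ultra_nat; have PU := @ultra_proper _ _ UU.
have FU : Filter U by exact: filter_filter.
have /choice[v hv] := scheme_exists.
pose wF n p j := F (grid n j) (v n p j).1 (v n p j).2.
pose wG n p j := G (grid n j) (v n p j).1 (v n p j).2.
(* Inserting linear part plus fractional sum into [x(1) = lambda x(eta)] and solving for the slope
   gives this quotient. The sums are defined at every [t], so [eta] need not be a grid point. *)
pose T1 n p := (frac_sum psi alpha n (wF n p) 1 - lambda * frac_sum psi alpha n (wF n p) eta) / D1.
pose T2 n p := (frac_sum psi beta n (wG n p) 1 - mu * frac_sum psi beta n (wG n p) xi) / D2.
have cv1 n j : continuous (fun p => (v n p j).1).
  by move=> p; apply: continuous_comp; [exact: (hv n).1|exact: cvg_fst].
have cv2 n j : continuous (fun p => (v n p j).2).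
  by move=> p; apply: continuous_comp; [exact: (hv n).1|exact: cvg_snd].
have cT1 n : continuous (T1 n).
  have cS t : continuous (fun p => frac_sum psi alpha n (wF n p) t).
    apply: frac_sum_param_continuous => j _ p.
    by apply: cF; [exact: cvg_cst|exact: cv1|exact: cv2].
  move=> p; apply: cvgMl; apply: cvgB; first exact: cS.
  by apply: cvgMr; exact: cS.
have cT2 n : continuous (T2 n).
  have cS t : continuous (fun p => frac_sum psi beta n (wG n p) t).
    apply: frac_sum_param_continuous => j _ p.
    by apply: cG; [exact: cvg_cst|exact: cv1|exact: cv2].
  move=> p; apply: cvgMl; apply: cvgB; first exact: cS.
  by apply: cvgMr; exact: cS.
have bT a (w : nat -> R) n (K l t D M : R) : 1 < a < 2 -> (forall j, `|w j| <= M) ->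
    t \in `[0, 1] -> `|(frac_sum psi a n w 1 - l * frac_sum psi a n w t) / D| <=
    (M * frac_scale psi a 1 + `|l| * (M * frac_scale psi a t)) / `|D|.
  move=> a12 wM t01; rewrite normrM normfV ler_wpM2r ?invr_ge0//.
  have bnd s : s \in `[0, 1] -> `|frac_sum psi a n w s| <= M * frac_scale psi a s.
    by move=> s01; apply: (frac_sum_bound psi psi_incr a a12 n w M s s01) => j _; exact: wM.
  rewrite (le_trans (ler_normB _ _))// lerD ?bnd// normrM ler_wpM2l// bnd//.
pose M1 := (MF * frac_scale psi alpha 1 + `|lambda| * (MF * frac_scale psi alpha eta)) / `|D1|.
pose M2 := (MG * frac_scale psi beta 1 + `|mu| * (MG * frac_scale psi beta xi)) / `|D2|.
have bT1 n p : `|T1 n p| <= M1 by apply: bT => // j; exact: bF.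
have bT2 n p : `|T2 n p| <= M2 by apply: bT => // j; exact: bG.
have M10 : 0 <= M1 := le_trans (normr_ge0 _) (bT1 0%N (0, 0)).
have M20 : 0 <= M2 := le_trans (normr_ge0 _) (bT2 0%N (0, 0)).
have /choice[p hp] n : exists p, T1 n p = p.1 /\ T2 n p = p.2.
  apply: (brouwer_plane _ _ (M1 + M2) (cT1 n) (cT2 n)) => p.
    by rewrite (le_trans (bT1 n p))// lerDl.
  by rewrite (le_trans (bT2 n p))// lerDr.
have [n|c _ pc] := @ultra_bounded_cvg R U UU (fun n => (p n).1) (- M1) M1.
  by rewrite in_itv/= -ler_norml -(hp n).1.
have [n|d _ pd] := @ultra_bounded_cvg R U UU (fun n => (p n).2) (- M2) M2.
  by rewrite in_itv/= -ler_norml -(hp n).2.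
pose uF n := wF n (p n); pose uG n := wG n (p n).
have uFM n j : (j <= n)%N -> `|uF n j| <= MF by move=> _; exact: bF.
have uGM n j : (j <= n)%N -> `|uG n j| <= MG by move=> _; exact: bG.
have [zx hzx] := frac_sum_limit _ _ _ _ alpha12 UU uFM.
have [zy hzy] := frac_sum_limit _ _ _ _ beta12 UU uGM.
(* Continuity and uniform convergence rest on the bound of the data alone. There is no circularity:
   they are used to identify the limit of the data in [nearv]. *)
have czx := frac_limit_cont psi psiC2 psi_incr alpha alpha12 U UU zx uF MF uFM hzx.
have czy := frac_limit_cont psi psiC2 psi_incr beta beta12 U UU zy uG MG uGM hzy.
pose x t := c * Psi t + zx t; pose y t := d * Psi t + zy t.
have cPsi : cont01 (fun t => Psi t).
  apply: (cont01_comp _ (fun s => s - psi 0)); first exact: psi_continuous.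
  by move=> s; apply: cvgB; [exact: cvg_id|exact: cvg_cst].
have cx : cont01 x by exact: cont01_lincomb.
have cy : cont01 y by exact: cont01_lincomb.
have cfield (H : R -> R -> R -> R) : (forall (T : Type) (V : set_system T) (FV : Filter V)
      (t x y : T -> R) (t0 x0 y0 : R), t @ V --> t0 -> x @ V --> x0 -> y @ V --> y0 ->
      (fun n => H (t n) (x n) (y n)) @ V --> H t0 x0 y0) -> cont01 (fun t => H t (x t) (y t)).
  move=> cH; apply/cont01P => t t01; apply: cH.
  - exact: cvg_within.
  - by move: t t01; apply/cont01P.
  - by move: t t01; apply/cont01P.
have cFxy := cfield _ cF; have cGxy := cfield _ cG.
(* Along a selection of grid points with limit [t0], the discrete solution and the limit functions
   both tend to [(x t0, y t0)], hence so do the two values of [H] to a common limit. *)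
have nearv (H : R -> R -> R -> R) : (forall (T : Type) (V : set_system T) (FV : Filter V)
      (t x y : T -> R) (t0 x0 y0 : R), t @ V --> t0 -> x @ V --> x0 -> y @ V --> y0 ->
      (fun n => H (t n) (x n) (y n)) @ V --> H t0 x0 y0) ->
    forall e, 0 < e -> \forall n \near U, forall j, (j <= n)%N ->
    `|H (grid n j) (v n (p n) j).1 (v n (p n) j).2 - H (grid n j) (x (grid n j)) (y (grid n j))| <= e.
  move=> cH e e0.
  apply: (@near_forall_selection U UU nat (fun n => [set j | (j <= n)%N])
    (fun n => [set j | `|H (grid n j) (v n (p n) j).1 (v n (p n) j).2 -
       H (grid n j) (x (grid n j)) (y (grid n j))| <= e])); first by move=> n; exists 0%N.
  move=> s sn; have g01 n : grid n (s n) \in `[(0 : R), 1] by exact/grid_itv/leqW/sn.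
  have [t0 t001 gt0] := @ultra_bounded_cvg R U UU _ 0 1 g01.
  have cP := @cont01_filter R nat U FU _ _ _ cPsi g01 t001 gt0.
  have val_cvg (q : nat -> R) (Z : nat -> R -> R) (k : R) (z : R -> R) : q @ U --> k ->
      cont01 z ->
      (forall e, 0 < e -> \forall n \near U, forall t, t \in `[0, 1] -> `|Z n t - z t| <= e) ->
      (fun n => q n * Psi (grid n (s n)) + Z n (grid n (s n))) @ U --> k * Psi t0 + z t0.
    move=> qk cz Zz; have cz' := @cont01_filter R nat U FU _ _ _ cz g01 t001 gt0.
    apply: cvgD; first by apply: cvgM; [exact: qk|exact: cP].
    have hd : (fun n => Z n (grid n (s n)) - z (grid n (s n))) @ U --> (0 : R).
      apply/cvgrPdist_le => e' e'0; have := Zz _ e'0; apply: filterS => n Zn.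
      by rewrite sub0r normrN; apply: Zn.
    rewrite (_ : (fun n => _) = (fun n => Z n (grid n (s n)) - z (grid n (s n)) +
      z (grid n (s n)))); last by apply/funext => n; rewrite subrK.
    by rewrite -[z t0]add0r; apply: cvgD; [exact: hd|exact: cz'].
  have v1 : (fun n => (v n (p n) (s n)).1) @ U --> x t0.
    rewrite (_ : (fun n => _) = (fun n => (p n).1 * Psi (grid n (s n)) +
      frac_sum psi alpha n (uF n) (grid n (s n)))).
      apply: (val_cvg (fun n => (p n).1) (fun n t => frac_sum psi alpha n (uF n) t) c zx pc czx) => e' e'0.
      exact: (frac_sum_uniform psi psiC2 psi_incr alpha alpha12 U UU zx uF MF uFM hzx).
    by apply/funext => n; have [-> _] := (hv n).2 (p n) (s n) (sn n).
  have v2 : (fun n => (v n (p n) (s n)).2) @ U --> y t0.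
    rewrite (_ : (fun n => _) = (fun n => (p n).2 * Psi (grid n (s n)) +
      frac_sum psi beta n (uG n) (grid n (s n)))).
      apply: (val_cvg (fun n => (p n).2) (fun n t => frac_sum psi beta n (uG n) t) d zy pd czy) => e' e'0.
      exact: (frac_sum_uniform psi psiC2 psi_incr beta beta12 U UU zy uG MG uGM hzy).
    by apply/funext => n; have [_ ->] := (hv n).2 (p n) (s n) (sn n).
  have xg := @cont01_filter R nat U FU _ _ _ cx g01 t001 gt0.
  have yg := @cont01_filter R nat U FU _ _ _ cy g01 t001 gt0.
  have l1 := cH nat U FU _ _ _ _ _ _ gt0 v1 v2; have l2 := cH nat U FU _ _ _ _ _ _ gt0 xg yg.
  have : (fun n => H (grid n (s n)) (v n (p n) (s n)).1 (v n (p n) (s n)).2 -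
      H (grid n (s n)) (x (grid n (s n))) (y (grid n (s n)))) @ U -->
      H t0 (x t0) (y t0) - H t0 (x t0) (y t0) by apply: cvgB; [exact: l1|exact: l2].
  rewrite subrr => /cvgrPdist_le/(_ _ e0).
  by apply: filterS => n; rewrite sub0r normrN.
have nF := nearv _ cF; have nG := nearv _ cG.
have slope (q : nat -> R) (Z : nat -> R -> R) (z : R -> R) (k l t D : R) : D != 0 -> q @ U --> k ->
    (forall t, t \in `[0, 1] -> (fun n => Z n t) @ U --> z t) -> t \in `[0, 1] ->
    (forall n, (Z n 1 - l * Z n t) / D = q n) -> k * D = z 1 - l * z t.
  move=> D0 qk Zz t01 Zq.
  have lim1 : (fun n => (Z n 1 - l * Z n t) / D) @ U --> (z 1 - l * z t) / D.
    apply: cvgMl; apply: cvgB; first exact: Zz.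
    by apply: cvgMr; exact: Zz.
  have lim2 : (fun n => (Z n 1 - l * Z n t) / D) @ U --> k.
    by rewrite (_ : (fun n => _) = q)//; apply/funext.
  by rewrite (cvg_unique _ lim2 lim1)// divfK.
exists c, d, x, y, zx, zy; split => //.
- apply: (frac_limit_Caputo psi psiC2 psi_incr dpsi_neq0 alpha alpha12 U UU sU _ zx uF MF
    cFxy uFM nF hzx c).
  by [].
- apply: (frac_limit_Caputo psi psiC2 psi_incr dpsi_neq0 beta beta12 U UU sU _ zy uG MG
    cGxy uGM nG hzy d).
  by [].
split; split => //.
- exact: (frac_limit_0 psi psi_incr alpha alpha12 U UU zx uF MF uFM hzx).
- move=> B FB t t01.
  exact: (frac_limit_sharp_bound psi psi_incr alpha alpha12 U UU _ zx uF nF hzx B t FB t01).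
- by apply: (slope (fun n => (p n).1) (fun n t => frac_sum psi alpha n (uF n) t) zx c lambda eta D1 D1_neq0 pc hzx eta01) => n; exact: (hp n).1.
- exact: (frac_limit_0 psi psi_incr beta beta12 U UU zy uG MG uGM hzy).
- move=> B GB t t01.
  exact: (frac_limit_sharp_bound psi psi_incr beta beta12 U UU _ zy uG nG hzy B t GB t01).
- by apply: (slope (fun n => (p n).2) (fun n t => frac_sum psi beta n (uG n) t) zy d mu xi D2 D2_neq0 pd hzy xi01) => n; exact: (hp n).2.
Qed.

End TwoEquations.
End CoupledSystem.

(** * A priori bounds *)

Section APriori.
Context {R : realType}.
Variable psi : R -> R.
Hypothesis psi_incr : {in `[0, 1] &, {homo psi : s t / s < t}}.
Local Notation Psi t := (psi t - psi 0).

(** If the right-hand side is at most [B], then [z] is at most [B * frac_scale psi a 1] and the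
    slope at most that times (|l| + 1) / |D|; linear and fractional parts together give [B] times
    this factor. *)
Definition apriori_factor (a l D : R) : R :=
  frac_scale psi a 1 * (1 + (`|l| + 1) / `|D| * Psi 1).

Let zero01 : (0 : R) \in `[0, 1]. Proof. by rewrite in_itv/= lexx ler01. Qed.
Let one01 : (1 : R) \in `[0, 1]. Proof. by rewrite in_itv/= lexx ler01. Qed.

Let Psi1 : 0 < Psi 1. Proof. by rewrite subr_gt0 psi_incr. Qed.

Lemma Omega_partE (a k l D : R) : Omega_part psi a k l D = k * apriori_factor a l D.
Proof.
rewrite /Omega_part /apriori_factor /frac_scale pos_powE ?(ltW Psi1)//.
rewrite powRD_gt0// powRr1 ?(ltW Psi1)//.
by ring.
Qed.

Lemma apriori_factor_ge0 (a l D : R) : 1 < a < 2 -> 0 <= apriori_factor a l D.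
Proof.
by move=> a12; rewrite mulr_ge0 ?frac_scale_ge0// addr_ge0// mulr_ge0 ?(ltW Psi1)// divr_ge0.
Qed.

Lemma apriori_bound (a l eta c D B : R) (x z : R -> R) : 1 < a < 2 -> D != 0 ->
  eta \in `[0, 1] -> 0 <= B -> (forall t, x t = c * Psi t + z t) ->
  {in `[0, 1], forall t, `|z t| <= B * frac_scale psi a t} ->
  c * D = z 1 - l * z eta ->
  {in `[0, 1], forall t, `|x t| <= B * apriori_factor a l D}.
Proof.
move=> a12 D0 eta01 B0 xE zB cD t t01; set S := frac_scale psi a 1.
have zS s : s \in `[0, 1] -> `|z s| <= B * S.
  move=> s01; rewrite (le_trans (zB _ s01))// ler_wpM2l//.
  apply: (frac_scale_homo psi psi_incr a a12) => //.
  by move: s01; rewrite in_itv/= => /andP[].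
have nD : 0 < `|D| by rewrite normr_gt0.
have c_le : `|c| <= B * S * (`|l| + 1) / `|D|.
  rewrite ler_pdivlMr// -normrM cD (le_trans (ler_normB _ _))// normrM.
  by rewrite mulrDr mulr1 addrC lerD ?zS// mulrC ler_wpM2r// zS.
have Pt0 : 0 <= Psi t.
  rewrite subr_ge0; apply: (psi_homo _ psi_incr) => //.
  by move: t01; rewrite in_itv/= => /andP[].
have Pt1 : Psi t <= Psi 1.
  rewrite lerD2r; apply: (psi_homo _ psi_incr) => //.
  by move: t01; rewrite in_itv/= => /andP[].
rewrite xE (le_trans (ler_normD _ _))// normrM [`|Psi t|]ger0_norm//.
apply: (@le_trans _ _ (B * S * (`|l| + 1) / `|D| * Psi 1 + B * S)).
  by rewrite lerD ?zS// ler_pM.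
by rewrite /apriori_factor -/S le_eqVlt; apply/orP; left; apply/eqP; ring.
Qed.

Lemma clamp_norm_le (rho u : R) : 0 <= rho -> `|clamp (- rho) rho u| <= `|u|.
Proof.
move=> r0; have := clamp_lipschitz (- rho) rho u 0.
by rewrite (clamp_id _ _ 0) ?subr0// in_itv/= r0 andbT oppr_le0.
Qed.

(** The uniform bound feeds Brouwer's theorem; the linear growth, inherited with the same constants,
    feeds the a priori estimate. *)
Lemma clamp_field_growth (f : R -> R -> R -> R) (k0 k1 k2 rho : R) : 0 <= rho ->
  0 <= k1 -> 0 <= k2 ->
  {in `[0, 1], forall t, forall x y : R, `|f t x y| <= k0 + k1 * `|x| + k2 * `|y|} ->
  forall t x y, `|clamp_field rho f t x y| <= k0 + k1 * `|x| + k2 * `|y| /\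
    `|clamp_field rho f t x y| <= k0 + k1 * rho + k2 * rho.
Proof.
move=> r0 k10 k20 fk t x y; have rr : - rho <= rho by lra.
have h := fk _ (clamp_itv 0 1 t ler01) (clamp (- rho) rho x) (clamp (- rho) rho y).
have cr u : `|clamp (- rho) rho u| <= rho.
  by have := clamp_itv (- rho) rho u rr; rewrite in_itv/= ler_norml.
by split; apply: (le_trans h); rewrite lerD ?lerD// ler_wpM2l// clamp_norm_le.
Qed.

End APriori.

(** * Removal of the truncation *)

Theorem theorem3p4 (R : realType) (alpha beta eta xi lambda mu : R)
  (psi : R -> R) (f g : R -> R -> R -> R) (k0 k1 k2 l0 l1 l2 : R)
  (Halpha : 1 < alpha < 2) (Hbeta : 1 < beta < 2)
  (Heta : 0 < eta < 1) (Hxi : 0 < xi < 1)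
  (Hlambda : 0 < lambda) (Hmu : 0 < mu)
  (HpsiC2 : C2_01 psi)
  (Hpsi_incr : {in `[0, 1] &, {homo psi : s t / s < t}})
  (Hpsi' : {in `[0, 1], forall t, deriv01 psi t != 0}) :
  let Delta1 := lambda * (psi eta - psi 0) - (psi 1 - psi 0) in
  let Delta2 := mu * (psi xi - psi 0) - (psi 1 - psi 0) in
  let Omega1 := Omega_part psi alpha k1 lambda Delta1
                + Omega_part psi beta l1 mu Delta2 in
  let Omega2 := Omega_part psi alpha k2 lambda Delta1
                + Omega_part psi beta l2 mu Delta2 in
  Delta1 != 0 -> Delta2 != 0 ->
  {within `[0, 1] `*` [set: R * R],
    continuous (fun p : R * (R * R) => f p.1 p.2.1 p.2.2)} ->
  {within `[0, 1] `*` [set: R * R],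
    continuous (fun p : R * (R * R) => g p.1 p.2.1 p.2.2)} ->
  0 < k0 -> 0 <= k1 -> 0 <= k2 -> 0 < l0 -> 0 <= l1 -> 0 <= l2 ->
  {in `[0, 1], forall t, forall x y : R,
    `|f t x y| <= k0 + k1 * `|x| + k2 * `|y|} ->
  {in `[0, 1], forall t, forall x y : R,
    `|g t x y| <= l0 + l1 * `|x| + l2 * `|y|} ->
  Num.max Omega1 Omega2 < 1 ->
  exists x y : R -> R,
    [/\ {within `[0, 1], continuous x} /\ {within `[0, 1], continuous y},
        psi_Caputo_eq alpha psi x (fun t => f t (x t) (y t)),
        psi_Caputo_eq beta psi y (fun t => g t (x t) (y t)),
        x 0 = 0 /\ y 0 = 0 &
        x 1 = lambda * x eta /\ y 1 = mu * y xi].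
Proof.
move=> Delta1 Delta2 Omega1 Omega2 D1 D2 cf cg k00 k10 k20 l00 l10 l20 fk gl Omega_lt1.
have eta01 : eta \in `[0, 1] by rewrite in_itv/=; case/andP: Heta => *; apply/andP; split; exact: ltW.
have xi01 : xi \in `[0, 1] by rewrite in_itv/=; case/andP: Hxi => *; apply/andP; split; exact: ltW.
pose Ea := apriori_factor psi alpha lambda Delta1.
pose Eb := apriori_factor psi beta mu Delta2.
have Ea0 : 0 <= Ea by exact: apriori_factor_ge0.
have Eb0 : 0 <= Eb by exact: apriori_factor_ge0.
have [om1_le om2_le] : k1 * Ea + l1 * Eb <= Num.max Omega1 Omega2 /\
    k2 * Ea + l2 * Eb <= Num.max Omega1 Omega2.
  by rewrite -!Omega_partE// !le_max !lexx orbT.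
set omega := Num.max Omega1 Omega2 in Omega_lt1 om1_le om2_le.
have om0 : 0 < 1 - omega by rewrite subr_gt0.
pose K := k0 * Ea + l0 * Eb.
have K0 : 0 <= K by rewrite addr_ge0// mulr_ge0// ltW.
(* The sum of the two suprema will satisfy [A + B <= K + omega * (A + B)]. This level, fixed before
   the solution is known, is what that inequality allows. *)
pose rho := K / (1 - omega).
have rho0 : 0 <= rho by rewrite divr_ge0// ltW.
have growth_f := clamp_field_growth f k0 k1 k2 rho rho0 k10 k20 fk.
have growth_g := clamp_field_growth g l0 l1 l2 rho rho0 l10 l20 gl.
have [c [d [x [y [zx [zy [cx cy xeq yeq [[xE zx0 zxB cD] [yE zy0 zyB dD]]]]]]]]] :=
  two_equations_solution psi HpsiC2 Hpsi_incr Hpsi' alpha beta Halpha Hbeta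
    (clamp_field rho f) (clamp_field rho g) (k0 + k1 * rho + k2 * rho) (l0 + l1 * rho + l2 * rho)
    (clamp_field_continuous rho f cf) (clamp_field_continuous rho g cg)
    (fun t x y => (growth_f t x y).2) (fun t x y => (growth_g t x y).2) eta xi lambda mu eta01 xi01 D1 D2.
have nc : continuous (fun u : R => `|u|) by exact: norm_continuous.
have [s1 s1I hA] := @EVT_max R (fun t => `|x t|) 0 1 ler01 (cont01_comp _ _ cx nc).
have [s2 s2I hB] := @EVT_max R (fun t => `|y t|) 0 1 ler01 (cont01_comp _ _ cy nc).
set A := `|x s1| in hA; set B := `|y s2| in hB.
have growth (a0 a1 a2 : R) : 0 <= a1 -> 0 <= a2 -> {in `[0, 1], forall s,
    a0 + a1 * `|x s| + a2 * `|y s| <= a0 + a1 * A + a2 * B}.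
  by move=> a10 a20 s s01; rewrite lerD ?lerD ?ler_wpM2l ?hA ?hB.
have A0 : 0 <= A by exact: normr_ge0.
have B0 : 0 <= B by exact: normr_ge0.
have hA' : A <= (k0 + k1 * A + k2 * B) * Ea.
  apply: (apriori_bound psi Hpsi_incr alpha lambda eta c Delta1 _ x zx Halpha D1 eta01 _ xE _ cD) => //.
    by rewrite !addr_ge0 ?mulr_ge0// ltW.
  by apply: zxB => s s01; apply: (le_trans (growth_f s (x s) (y s)).1); exact: growth.
have hB' : B <= (l0 + l1 * A + l2 * B) * Eb.
  apply: (apriori_bound psi Hpsi_incr beta mu xi d Delta2 _ y zy Hbeta D2 xi01 _ yE _ dD) => //.
    by rewrite !addr_ge0 ?mulr_ge0// ltW.
  by apply: zyB => s s01; apply: (le_trans (growth_g s (x s) (y s)).1); exact: growth.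
(* Add [hA'] and [hB']: the coefficients of [A] and of [B] are the two sums bounded by [omega]. *)
have AB : A + B <= rho.
  rewrite ler_pdivlMr//.
  have := ler_wpM2r A0 om1_le; have := ler_wpM2r B0 om2_le; rewrite /K; lra.
have xr t : t \in `[0, 1] -> clamp (- rho) rho (x t) = x t.
  move=> t01; apply: clamp_id; rewrite in_itv/= -ler_norml (le_trans (hA _ t01))//.
  by rewrite (le_trans _ AB)// lerDl.
have yr t : t \in `[0, 1] -> clamp (- rho) rho (y t) = y t.
  move=> t01; apply: clamp_id; rewrite in_itv/= -ler_norml (le_trans (hB _ t01))//.
  by rewrite (le_trans _ AB)// lerDr.
have boundary (k : R) (z w : R -> R) (l s : R) : (forall t, w t = k * (psi t - psi 0) + z t) ->
    k * (l * (psi s - psi 0) - (psi 1 - psi 0)) = z 1 - l * z s -> w 1 = l * w s.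
  move=> wE kE; rewrite !wE (_ : z 1 = k * (l * (psi s - psi 0) - (psi 1 - psi 0)) + l * z s).
    by ring.
  by rewrite kE subrK.
exists x, y; split => //.
- case: xeq => dx xeq; split => // t t01; rewrite xeq// /clamp_field xr// yr//.
  by rewrite clamp_id.
- case: yeq => dy yeq; split => // t t01; rewrite yeq// /clamp_field xr// yr//.
  by rewrite clamp_id.
- by rewrite xE yE !subrr !mulr0 zx0 zy0 !addr0.
- by split; [exact: boundary xE cD|exact: boundary yE dD].
Qed.
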